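(* Let $p$ be a prime and let $k,n$ be natural numbers with $k+1\le p$ and $n+2\le p$. Fix an abelian group $(A,+)$ of cardinality $p^n$. Then the map sending a nilpotent pre-Lie ring $(A,+,\cdot)$ of nilpotency index $k$ to its group-of-flows brace $(A,+,\circ)$ is a bijection from the set of nilpotent pre-Lie ring structures on $(A,+)$ of nilpotency index $k$ onto the set of strongly nilpotent (left) brace structures on $(A,+)$ of nilpotency index $k$. Its inverse sends a strongly nilpotent brace $(A,+,\circ)$ to its associated pre-Lie ring $(A,+,\odot)$. In particular there is a one-to-one correspondence between strongly nilpotent braces of cardinality $p^n$ and nilpotency index $k$ and nilpotent pre-Lie rings of cardinality $p^n$ and nilpotency index $k$.
   Context: A (left) brace is a set $A$ with binary operations $+,\circ$ such that $(A,+)$ is an abelian group, $(A,\circ)$ is a group, and $a\circ(b+c)+a=a\circ b+a\circ c$ for all $a,b,c$. Write $a*b=a\circ b-a-b$. For additive subgroups $X,Y$, $X*Y$ is the additive subgroup generated by all $x*y$ ($x\in X,y\in Y$). Set $A^{1}=A^{(1)}=A^{[1]}=A$, $A^{i+1}=A*A^{i}$, $A^{(i+1)}=A^{(i)}*A$, $A^{[i+1]}=\sum_{j=1}^{i}A^{[j]}*A^{[i+1-j]}$. A brace is left nilpotent if $A^m=0$ for some $m$, right nilpotent if $A^{(m)}=0$ for some $m$, strongly nilpotent if $A^{[m]}=0$ for some $m$; it has nilpotency index $k$ if $A^{[k]}=0\ne A^{[k-1]}$. For an integer $m$, $ma$ is the $m$-fold additive multiple. A pre-Lie ring is an abelian group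 $(A,+)$ with a biadditive product $\cdot$ satisfying $(x\cdot y)\cdot z-x\cdot(y\cdot z)=(y\cdot x)\cdot z-y\cdot(x\cdot z)$. The series $A^i$, $A^{(i)}$, $A^{[i]}$ and the notions left nilpotent, right nilpotent, nilpotent (=strongly nilpotent: $A^{[m]}=0$ for some $m$, equivalently all products of $m$ elements with any bracketing vanish) and nilpotency index $k$ ($A^{[k]}=0\neq A^{[k-1]}$) are defined as for braces with $\cdot$ in place of $*$. Group of flows: let $(A,+,\cdot)$ be a left nilpotent pre-Lie ring of cardinality $p^n$ with $p>n+1$ prime. Let $A^{\mathrm{id}}=A\times\mathbb Z$ with $(r,m)+(s,m')=(r+s,m+m')$, $(r,m)\cdot(s,m')=(r\cdot s+ms+m'r,mm')$; identify $A$ with $A\times\{0\}$, put $1=(0,1)$. For $a\in A$ let $L_a(x)=a\cdot x$ and $e^{L_a}(x)=\sum_{j\ge 0}\frac{1}{j!}L_a^j(x)$ for $x\in A^{\mathrm{id}}$ (finite sum since $A^{n+1}=0$; the needed factorials are invertible modulo $p^n$). Let $W(a)=e^{L_a}(1)-1\in A$; $W:A\to A$ is a bijection, with inverse $\Omega$. The group of flows is $(A,\circ)$ with $a\circ b=a+e^{L_{\Omega(a)}}(b)$, and $(A,+,\circ)$ is the group-of-flows brace. Associated pre-Lie ring: let $\gamma$ be a primitive root modulo $p^p$ and $\xi=\gamma^{p^{p-1}}$. For a brace $(A,+,\circ)$ of cardinality $p^n$ define $a\cdot b=\sum_{i=0}^{p-2}\xi^{p-1-i}((\xi^i a)*b)$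 and $a\odot b=-(1+p+p^2+\dots+p^{n-1})(a\cdot b)$; $(A,+,\odot)$ is the pre-Lie ring associated to the brace. *)

(* Defs.v *)
From HB Require Import structures.
From mathcomp Require Import all_boot all_order all_algebra.
Set Implicit Arguments. Unset Strict Implicit. Unset Printing Implicit Defensive.
Import GRing.Theory.
Local Open Scope ring_scope.

Section Defs.
Variable A : finZmodType.

Definition is_addsubgroup (H : {set A}) : bool :=
  (0 \in H) && [forall x in H, forall y in H, x - y \in H].

Definition addgen (S : {set A}) : {set A} :=
  \bigcap_(H : {set A} | is_addsubgroup H && (S \subset H)) H.

Definition star_set (op : A -> A -> A) (X Y : {set A}) : {set A} :=
  addgen [set op x y | x in X, y in Y].

(* Strong series: S 1 = A,  S (i+1) = sum_{j=1}^{i} S j * S (i+1-j).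
   Computed with fuel; ser_fuel f m is correct whenever m <= f.+1.
   Convention: S 0 = A as well. *)
Fixpoint ser_fuel (op : A -> A -> A) (f : nat) : nat -> {set A} :=
  match f with
  | 0 => fun _ => setT
  | f'.+1 => fun m =>
      if (m <= 1)%N then setT
      else addgen (\bigcup_(1 <= j < m) star_set op (ser_fuel op f' j) (ser_fuel op f' (m - j)))
  end.

Definition strong_ser (op : A -> A -> A) (m : nat) : {set A} := ser_fuel op m m.

Definition has_nil_index (op : A -> A -> A) (k : nat) : Prop :=
  strong_ser op k = [set 0] /\ strong_ser op k.-1 <> [set 0].

Definition is_preLie (mul : A -> A -> A) : Prop :=
  (forall x y z, mul (x + y) z = mul x z + mul y z) /\
  (forall x y z, mul x (y + z) = mul x y + mul x z) /\
  (forall x y z, mul (mul x y) z - mul x (mul y z) = mul (mul y x) z - mul y (mul x z)).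

Definition is_nilpotent_preLie_index (mul : A -> A -> A) (k : nat) : Prop :=
  is_preLie mul /\ has_nil_index mul k.

Definition is_group_op (op : A -> A -> A) : Prop :=
  (forall a b c, op a (op b c) = op (op a b) c) /\
  exists e, (forall a, op e a = a /\ op a e = a) /\
            (forall a, exists b, op a b = e /\ op b a = e).

Definition is_brace (circ : A -> A -> A) : Prop :=
  is_group_op circ /\
  (forall a b c, circ a (b + c) + a = circ a b + circ a c).

Definition brace_star (circ : A -> A -> A) (a b : A) : A := circ a b - a - b.

Definition is_snilpotent_brace_index (circ : A -> A -> A) (k : nat) : Prop :=
  is_brace circ /\ has_nil_index (brace_star circ) k.

(* Multiplication by 1/d on A, i.e. by an inverse of d modulo #|A| (= p^n). *)
Definition inv_nat_mul (d : nat) (x : A) : A := x *+ (egcdn d #|A|).1.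

Definition expL (n : nat) (mul : A -> A -> A) (a x : A) : A :=
  \sum_(j < n.+1) inv_nat_mul (j`!) (iter j (mul a) x).

(* W(a) = e^{L_a}(1) - 1 = sum_{j=1}^{n+1} 1/j! L_a^{j-1}(a),
   since L_a(1) = a in A^id. *)
Definition flowW (n : nat) (mul : A -> A -> A) (a : A) : A :=
  \sum_(j < n.+1) inv_nat_mul (j.+1`!) (iter j (mul a) a).

Definition flowOmega (n : nat) (mul : A -> A -> A) (a : A) : A :=
  odflt 0 [pick b | flowW n mul b == a].

Definition flows_circ (n : nat) (mul : A -> A -> A) (a b : A) : A :=
  a + expL n mul (flowOmega n mul a) b.

Definition assoc_dot (p gamma : nat) (circ : A -> A -> A) (a b : A) : A :=
  let xi := (gamma ^ (p ^ p.-1))%N in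
  \sum_(i < p.-1) (brace_star circ (a *+ (xi ^ i)) b) *+ (xi ^ (p.-1 - i)).

Definition assoc_odot (p n gamma : nat) (circ : A -> A -> A) (a b : A) : A :=
  - (assoc_dot p gamma circ a b *+ (\sum_(i < n) p ^ i)%N).

End Defs.

Definition primitive_root_mod (g m : nat) : Prop :=
  coprime g m /\ (forall i, (0 < i < totient m)%N -> (g ^ i %% m <> 1 %% m)%N).

(* Main.v *)
(* Both constructions are studied through functions [nat -> A] that are
   polynomials [m |-> sum_l a_l m^l] with [a_l] in the l-th term of the strong
   series.  Nilpotency of index [k < p] bounds their degree by [p - 2], so the
   average over (p-1)-st roots of unity modulo [p^n] which defines the product
   [odot] extracts exactly the coefficient of degree one, and such functions can
   be differentiated and integrated.

   From pre-Lie rings to braces: the right logarithmic derivative of [exp L_u] is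
   again a left multiplication [L_w], where [w] is read off by applying both
   sides to [1].  Along [y(t) = e^{t L_a}(1 + x) - 1] this gives [w = a], so
   [exp L_{Omega(y(t))}] solves [X' = L_a X]; hence
   [exp L_{Omega(a o b)} = exp L_{Omega(a)} exp L_{Omega(b)}], which is the
   associativity of the group of flows.

   From braces to pre-Lie rings: [(m a) * b] is a polynomial in [m] because its
   iterated finite differences descend the strong series.  Its linear part [odot]
   is additive in [a], and writing [lam_x] for [b |-> b + x * b], differentiating
   [lam_{x o y} = lam_x lam_y] yields
   [lam_x ((lam_x^{-1} (y + y odot x)) odot c) = y odot lam_x c].  The linear part
   in [x] of this identity is the pre-Lie identity; read along [x = W(t a)] it is
   the differential equation [X' = L_a X], so that [lam_{W(a)} = exp L_a] and the
   brace is the group of flows of [odot]. *)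
Require Import Defs.
From mathcomp Require Import all_boot all_algebra all_fingroup all_solvable zify.
Import GRing.Theory.
Set Implicit Arguments. Unset Strict Implicit. Unset Printing Implicit Defensive.
Local Open Scope ring_scope.

(** * Additive maps between abelian groups *)

Section AdditiveMaps.
Variables (U V : zmodType) (f : U -> V).
Hypothesis fD : {morph f : x y / x + y}.

Lemma morph_add0 : f 0 = 0.
Proof. by apply: (addrI (f 0)); rewrite -fD !addr0. Qed.

Lemma morph_addN x : f (- x) = - f x.
Proof. by apply: (addrI (f x)); rewrite -fD !subrr morph_add0. Qed.

Lemma morph_addB x y : f (x - y) = f x - f y.
Proof. by rewrite fD morph_addN. Qed.

Lemma morph_addMn x m : f (x *+ m) = f x *+ m.
Proof. by elim: m => [|m IH]; rewrite ?mulr0n ?morph_add0 // !mulrS fD IH. Qed.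

Lemma morph_add_sum I (r : seq I) (P : pred I) (F : I -> U) :
  f (\sum_(i <- r | P i) F i) = \sum_(i <- r | P i) f (F i).
Proof. by apply: (big_morph f fD morph_add0). Qed.

End AdditiveMaps.

Lemma iter_morph_add (U : zmodType) (f : U -> U) j :
  {morph f : x y / x + y} -> {morph iter j f : x y / x + y}.
Proof. by move=> fD x y; elim: j => //= j ->; rewrite fD. Qed.

(** * Additive subgroups and the strong series *)

Section Subgroups.
Variable A : finZmodType.
Implicit Types (H X Y : {set A}).

Lemma addsubgroupP H :
  reflect (0 \in H /\ forall x y, x \in H -> y \in H -> x - y \in H)
          (is_addsubgroup H).
Proof.
apply: (iffP andP) => -[H0 HB]; split=> //.
  by move=> x y Hx Hy; move/forall_inP/(_ x Hx)/forall_inP: HB; apply.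
by apply/forall_inP=> x Hx; apply/forall_inP=> y Hy; apply: HB.
Qed.

Lemma addgenP X : is_addsubgroup (addgen X).
Proof.
apply/addsubgroupP; split.
  by apply/bigcapP=> H /andP[/addsubgroupP[]].
move=> x y /bigcapP Hx /bigcapP Hy; apply/bigcapP=> H HX.
case/andP: (HX) => /addsubgroupP[_ HB] _.
by apply: HB; [apply: Hx | apply: Hy].
Qed.

Lemma sub_addgen X : X \subset addgen X.
Proof.
by apply/subsetP=> x Xx; apply/bigcapP=> H /andP[_ /subsetP]; apply.
Qed.

Lemma addgen_sub X H : is_addsubgroup H -> X \subset H -> addgen X \subset H.
Proof. by move=> sH XH; apply: bigcap_inf; rewrite sH. Qed.

Lemma addsubgroup_setT : is_addsubgroup [set: A].
Proof. by apply/addsubgroupP; split=> // *; rewrite inE. Qed.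

Lemma card_addsubgroup_dvd H X :
  is_addsubgroup H -> is_addsubgroup X -> H \subset X -> (#|H| %| #|X|)%N.
Proof.
have gr Y : is_addsubgroup Y -> group_set Y.
  case/addsubgroupP=> Y0 YB; apply/group_setP; split=> // x y Yx Yy.
  by rewrite FinRing.Theory.zmodMgE -[y]opprK; apply: (YB) => //; rewrite -sub0r; apply: YB.
by move=> /gr gH /gr gX; apply: (@cardSg _ (Group gX) (Group gH)).
Qed.

(* The kernels of the iterates form a chain of subgroups that stabilises as
   soon as two consecutive terms agree. *)
Lemma nilpotent_iter_bound p n (f : A -> A) M :
  prime p -> #|A| = (p ^ n)%N -> {morph f : x y / x + y} ->
  (forall x, iter M f x = 0) -> forall x, iter n f x = 0.
Proof.
move=> pp cA fD fM; pose K i := [set x | iter i f x == 0].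
have sK i : is_addsubgroup (K i).
  have iD := iter_morph_add i fD.
  apply/addsubgroupP; split; first by rewrite inE (morph_add0 iD).
  move=> x y; rewrite !inE => /eqP Hx /eqP Hy.
  by rewrite (morph_addB iD) Hx Hy subr0.
have KS i : K i \subset K i.+1.
  by apply/subsetP=> x; rewrite !inE /= => /eqP->; rewrite (morph_add0 fD).
have stab i : K i = K i.+1 -> K i = setT.
  move=> e; apply/setP=> x; rewrite !inE.
  have: forall j, iter (j + i) f x == 0 -> iter i f x == 0.
    elim=> // j IH; rewrite addSnnS addnC iterD => h; apply: IH.
    have: iter j f x \in K i.+1 by rewrite inE.
    by rewrite -e inE -iterD addnC.
  by move/(_ M); rewrite addnC iterD fM (morph_add0 (iter_morph_add _ fD)) eqxx; apply.
(* A strict inclusion between subgroups of [p]-power order multiplies the order by at least [p]. *)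
have big i : K i = setT \/ (p ^ i <= #|K i|)%N.
  elim: i => [|i [e|IH]].
  - by right; rewrite expn0 card_gt0; apply/set0Pn; exists 0; rewrite inE.
  - by left; apply/eqP; rewrite eqEsubset subsetT -e KS.
  have [e|ne] := eqVneq (K i) (K i.+1).
    by left; rewrite -e; apply: stab.
  right; have lt: (#|K i| < #|K i.+1|)%N.
    by apply: proper_card; rewrite properEneq ne KS.
  have d: (#|K i| %| #|K i.+1|)%N by apply: card_addsubgroup_dvd.
  have dA j : (#|K j| %| p ^ n)%N.
    by rewrite -cA -cardsT; apply: card_addsubgroup_dvd (subsetT _) => //;
       apply: addsubgroup_setT.
  have /dvdn_pfactor-/(_ pp)[a _ ea] := dA i.
  have /dvdn_pfactor-/(_ pp)[b _ eb] := dA i.+1.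
  move: lt IH; rewrite ea eb ltn_exp2l ?prime_gt1 // leq_exp2l ?prime_gt1 //.
  by move=> lt le; rewrite leq_exp2l ?prime_gt1 //; apply: leq_ltn_trans lt.
have e: K n = setT.
  case: (big n) => // h; apply/eqP; rewrite eqEcard subsetT cardsT cA.
  exact: h.
by move=> x; apply/eqP; have := in_setT x; rewrite -e inE.
Qed.

Section StrongSeries.
Variable op : A -> A -> A.
Local Notation T := (strong_ser op).

Lemma ser_fuel_stable f g m :
  (m <= f.+1)%N -> (m <= g.+1)%N -> ser_fuel op f m = ser_fuel op g m.
Proof.
elim: f g m => [|f IH] [|g] m //= hf hg; first by rewrite hf.
  by rewrite hg.
case: leqP => // m1; congr addgen.
apply: eq_big_nat => j /andP[j0 jm]; congr star_set; apply: IH; lia.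
Qed.

Lemma strong_ser0 : T 0 = setT. Proof. by []. Qed.
Lemma strong_ser1 : T 1 = setT. Proof. by []. Qed.

Lemma strong_serE m : (1 < m)%N ->
  T m = addgen (\bigcup_(1 <= j < m) star_set op (T j) (T (m - j))).
Proof.
case: m => // m m1; rewrite /strong_ser /= leqNgt m1 /=; congr addgen.
by apply: eq_big_nat => j /andP[j0 jm]; congr star_set; apply: ser_fuel_stable; lia.
Qed.

Lemma strong_ser_subgroup m : is_addsubgroup (T m).
Proof.
case: (ltnP 1 m) => m1; first by rewrite strong_serE // addgenP.
by case: m m1 => [|[|]] // _; rewrite ?strong_ser0 ?strong_ser1 addsubgroup_setT.
Qed.

Lemma strong_ser_op1 i j x y : (0 < i)%N -> (0 < j)%N ->
  x \in T i -> y \in T j -> op x y \in T (i + j).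
Proof.
move=> i0 j0 Tx Ty; rewrite strong_serE; last by lia.
apply: (subsetP (sub_addgen _)).
rewrite big_geq_mkord /=; have ij: (i < i + j)%N by lia.
apply/bigcupP; exists (Ordinal ij) => //=.
apply: (subsetP (sub_addgen _)); rewrite addKn.
by apply: imset2_f.
Qed.

(** Minimality of the strong series: the series of two operations are compared by showing that one
    operation is graded for the series of the other. *)
Lemma strong_ser_min (H : nat -> {set A}) :
  (forall i, is_addsubgroup (H i)) -> H 0 = setT -> H 1 = setT ->
  (forall i j x y, (0 < i)%N -> (0 < j)%N ->
     x \in H i -> y \in H j -> op x y \in H (i + j)%N) ->
  forall i, T i \subset H i.
Proof.
move=> sH H0 H1 Hop i; have [m] := ubnP i; elim: m i => // m IH i im.
case: (ltnP 1 i) => i1; last first.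
  by case: i i1 {im} => [|[|]] // _; rewrite ?H0 ?H1 subsetT.
rewrite strong_serE //; apply: addgen_sub => //.
rewrite big_geq_mkord /=; apply/bigcupsP=> j j0.
apply: addgen_sub => //; apply/subsetP=> z /imset2P[x y Tx Ty ->].
have -> : i = (j + (i - j))%N by have := ltn_ord j; lia.
have ji := ltn_ord j.
apply: Hop; first lia; first lia.
  by apply: (subsetP (IH _ _)) Tx; lia.
by apply: (subsetP (IH _ _)) Ty; lia.
Qed.

Lemma strong_serS i : T i.+1 \subset T i.
Proof.
have [m] := ubnP i; elim: m i => // m IH i im.
case: i im => [|i] im; first by rewrite strong_ser0 subsetT.
rewrite [T i.+2]strong_serE //; apply: addgen_sub; first exact: strong_ser_subgroup.
rewrite big_geq_mkord /=; apply/bigcupsP=> -[j ji] /= j0.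
apply: addgen_sub; first exact: strong_ser_subgroup.
apply/subsetP=> z /imset2P[x y Tx Ty ->].
(* The weight of the right factor is lowered by one, unless it is already one; then the left factor
   is lowered instead. *)
case: (ltnP j i.+1) => h.
  have -> : i.+1 = (j + (i.+1 - j))%N by lia.
  apply: strong_ser_op1 => //; first lia.
  by apply: (subsetP (IH _ _)); [lia | rewrite -subSn //; lia].
have ej : j = i.+1 by lia.
case: i im ji h ej Ty => [|i] im ji h ej Ty; first by rewrite strong_ser1 inE.
rewrite ej in Tx.
have -> : i.+2 = (i.+1 + 1)%N by lia.
apply: strong_ser_op1; rewrite ?strong_ser1 ?inE //.
by apply: (subsetP (IH _ _)) Tx; lia.
Qed.

End StrongSeries.
End Subgroups.

(** * Filtrations descending to zero and graded operations *)

Record filtration (A : finZmodType) (k : nat) (T : nat -> {set A}) : Prop :=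
  Filtration {
    filt_sub : forall i, is_addsubgroup (T i);
    filt1 : T 1 = setT;
    filtS : forall i, T i.+1 \subset T i;
    filt_nil : T k = [set 0] }.

(** The filtration is kept separate from [op], because a brace operation and its pre-Lie product
    must be graded for one and the same series. *)
Definition graded_op (A : finZmodType) (T : nat -> {set A}) (op : A -> A -> A) :=
  forall i j x y, x \in T i -> y \in T j -> op x y \in T (i + j)%N.

Section FiltrationTheory.
Variables (A : finZmodType) (k : nat) (T : nat -> {set A}).
Hypothesis FT : filtration k T.

Lemma filt0 i : 0 \in T i.
Proof. by case/addsubgroupP: (filt_sub FT i). Qed.

Lemma filtB i x y : x \in T i -> y \in T i -> x - y \in T i.
Proof. by case/addsubgroupP: (filt_sub FT i) => _; apply. Qed.

Lemma filtN i x : x \in T i -> - x \in T i.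
Proof. by rewrite -sub0r; apply: filtB (filt0 i). Qed.

Lemma filtD i x y : x \in T i -> y \in T i -> x + y \in T i.
Proof. by move=> Tx Ty; rewrite -[y]opprK; apply: filtB (filtN Ty). Qed.

Lemma filtMn i x m : x \in T i -> x *+ m \in T i.
Proof.
by move=> Tx; elim: m => [|m IH]; rewrite ?mulr0n ?filt0 // mulrS filtD.
Qed.

Lemma filt_sum i I (r : seq I) (P : pred I) (F : I -> A) :
  (forall j, P j -> F j \in T i) -> \sum_(j <- r | P j) F j \in T i.
Proof.
by move=> TF; elim/big_rec: _ => [|j x Pj Tx]; [apply: filt0 | apply: filtD; auto].
Qed.

Lemma filt_le i j x : (i <= j)%N -> x \in T j -> x \in T i.
Proof.
move/subnK <-; elim: (j - i)%N => //= m IH; rewrite addSn => Tx.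
by apply: IH; apply: (subsetP (filtS FT _)).
Qed.

Lemma filtT1 x : x \in T 1. Proof. by rewrite (filt1 FT) inE. Qed.
Lemma filtT0 x : x \in T 0. Proof. exact: filt_le (filtT1 x). Qed.

Lemma filt_eq0 i x : (k <= i)%N -> x \in T i -> x = 0.
Proof. by move=> ki /(filt_le ki); rewrite (filt_nil FT) inE => /eqP. Qed.

(* [f - id] raises the filtration degree of differences, so [f x = f y] puts
   [x - y] in every [T i]. *)
Lemma filt_contraction_inj (f : A -> A) :
  (forall i x y, x - y \in T i -> (f x - f y) - (x - y) \in T i.+1) -> injective f.
Proof.
move=> hf x y e; apply/eqP; rewrite -subr_eq0; apply/eqP.
suff: forall i, x - y \in T i by move/(_ k); apply: filt_eq0.
elim=> [|i IH]; first exact: filtT0.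
by have := filtN (hf _ _ _ IH); rewrite e subrr sub0r opprK.
Qed.

Lemma graded_iter op i j a x : graded_op T op ->
  a \in T i -> x \in T j -> forall m, iter m (op a) x \in T (m * i + j)%N.
Proof.
move=> gop Ta Tx m; elim: m => [|m IH] //=; rewrite mulSn -addnA; exact: gop.
Qed.

End FiltrationTheory.

(** An index zero is raised to one, and the extra weight is given up because the series
    decreases. *)
Lemma strong_ser_graded (A : finZmodType) (op : A -> A -> A) :
  graded_op (strong_ser op) op.
Proof.
move=> [|i] [|j] x y Tx Ty; rewrite ?add0n ?addn0.
- by rewrite strong_ser0 inE.
- apply: (subsetP (strong_serS _ _)).
  by apply: (@strong_ser_op1 _ op 1 j.+1); rewrite // strong_ser1 inE.
- apply: (subsetP (strong_serS _ _)); rewrite -addn1.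
  by apply: (@strong_ser_op1 _ op i.+1 1); rewrite // strong_ser1 inE.
exact: strong_ser_op1.
Qed.

Lemma strong_ser_filtration (A : finZmodType) (op : A -> A -> A) k :
  strong_ser op k = [set 0] -> filtration k (strong_ser op).
Proof.
by move=> ?; split=> //; [apply: strong_ser_subgroup | apply: strong_serS].
Qed.

(** Allows the cut-offs of the definitions and of the Newton expansion to be replaced by [k], from
    which on all terms vanish by weight. *)
Lemma big_ord_trunc (V : nmodType) (F : nat -> V) a b :
  (forall j, (a <= j)%N -> F j = 0) -> (forall j, (b <= j)%N -> F j = 0) ->
  \sum_(j < a) F j = \sum_(j < b) F j.
Proof.
have widen c d : (forall j, (c <= j)%N -> F j = 0) ->
    \sum_(j < c + d) F j = \sum_(j < c) F j.
  move=> F0; rewrite big_split_ord /= [X in _ + X]big1 ?addr0 // => j _.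
  by rewrite F0 // leq_addr.
by move=> Fa Fb; rewrite -(widen a b Fa) -(widen b a Fb) addnC.
Qed.

(** * Extraction of linear coefficients *)

Section Teichmueller.
Variables (p gamma : nat).
Hypotheses (pp : prime p) (gP : primitive_root_mod gamma (p ^ p)).
Local Notation xi := (gamma ^ (p ^ p.-1))%N.

(** In [a^p - 1 = (a - 1)(1 + a + ... + a^(p-1))] the second factor is a sum of [p] terms congruent
    to 1 modulo [p]. *)
Lemma exp_prime_mod1 a m :
  (0 < m)%N -> (a = 1 %[mod p ^ m] -> a ^ p = 1 %[mod p ^ m.+1])%N.
Proof.
move=> m0 /eqP e; have p1 := prime_gt1 pp.
have a0 : (0 < a)%N.
  rewrite lt0n; apply/eqP => a0; move: e; rewrite a0 mod0n modn_small //.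
  by rewrite -{1}(expn0 p) ltn_exp2l.
apply/eqP; move: e; rewrite !eqn_mod_dvd ?expn_gt0 ?a0 // !subn1 => d.
rewrite predn_exp expnSr dvdn_mul //.
rewrite /dvdn -modn_summ.
have am : (a = 1 %[mod p])%N.
  apply/eqP; rewrite eqn_mod_dvd // subn1; apply: dvdn_trans d.
  by rewrite -{1}(expn1 p) dvdn_exp2l.
under eq_bigr => i _ do rewrite -modnXm am modnXm exp1n.
by rewrite modn_summ sum1_card card_ord modnn.
Qed.

Lemma expX_prime_mod1 a m : (a = 1 %[mod p] -> a ^ (p ^ m) = 1 %[mod p ^ m.+1])%N.
Proof.
move=> e; elim: m => [|m IH]; first by rewrite expn0 !expn1.
by rewrite expnSr expnM exp_prime_mod1.
Qed.

Lemma xi_exp_pred : (xi ^ p.-1 = 1 %[mod p ^ p])%N.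
Proof.
have p0 := prime_gt0 pp.
rewrite -expnM mulnC -totient_pfactor //.
by apply: Euler_exp_totient; case: gP.
Qed.

(** A congruence modulo [p] would lift to [(xi^i)^(p^(p-1)) = 1] modulo [p^p]. Since [p^(p-1)] is 1
    modulo [p - 1], the left side is [xi^i], a power of [gamma] with exponent below the totient. *)
Lemma xi_exp_neq1 i : (0 < i < p.-1)%N -> (xi ^ i <> 1 %[mod p])%N.
Proof.
move=> /andP[i0 ip] /(@expX_prime_mod1 _ p.-1).
have p0 := prime_gt0 pp; rewrite (prednK p0) => e.
case: gP => _ /(_ (i * p ^ p.-1)%N); apply.
  by rewrite totient_pfactor // muln_gt0 i0 expn_gt0 p0 ltn_pmul2r // expn_gt0 p0.
have [q eq] : exists q, (p ^ p.-1 = 1 + p.-1 * q)%N.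
  exists (\sum_(i < p.-1) p ^ i)%N; rewrite -predn_exp add1n prednK //.
  by rewrite expn_gt0 p0.
rewrite -{}e mulnC expnM.
have -> : ((xi ^ i) ^ (p ^ p.-1) = xi ^ i * (xi ^ p.-1) ^ (q * i))%N.
  by rewrite -!expnM -expnD {2}eq; congr expn; lia.
by rewrite -modnMmr -(modnXm _ _ (xi ^ p.-1)) xi_exp_pred modnXm exp1n modnMmr muln1.
Qed.

Definition xi_sum l := (\sum_(i < p.-1) xi ^ (l * i) * xi ^ (p.-1 - i))%N.

Lemma xi_sum1 : (xi_sum 1 = p.-1 %[mod p ^ p])%N.
Proof.
rewrite /xi_sum (eq_bigr (fun=> xi ^ p.-1)%N) => [|i _]; last first.
  by rewrite mul1n -expnD subnKC // ltnW.
by rewrite sum_nat_const card_ord -modnMmr xi_exp_pred modnMmr muln1.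
Qed.

(* Multiplying by [xi ^ l] shifts the summation index, up to a factor [xi]. *)
Lemma xi_sum0 l : (2 < p)%N -> (l < p.-1)%N -> l != 1%N -> (p ^ p %| xi_sum l)%N.
Proof.
move=> p2 lp l1; have p0 := prime_gt0 pp; have p1 : (0 < p.-1)%N by lia.
have cop : coprime xi (p ^ p).
  by case: gP => cg _; rewrite coprimeXl // coprimeXr // -(coprime_pexpr _ _ p0).
have xp : coprime xi p by rewrite -(coprime_pexpr _ _ p0).
have e : (xi ^ l * xi_sum l = xi * xi_sum l %[mod p ^ p])%N.
  (* The added term completes both sides to the same sum over [p] indices, with its first term split
     off on the left and its last term on the right. *)
  apply/eqP; rewrite -(eqn_modDr (xi * xi ^ p.-1)); apply/eqP.
  transitivity (((\sum_(i < p.-1.+1) xi ^ (l * i) * xi ^ (p.-1 - i)) * xi) %% p ^ p)%N.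
    rewrite big_ord_recl /= muln0 mul1n subn0 mulnDl; congr (_ %% _)%N.
    rewrite addnC [(xi * _)%N]mulnC; congr addn.
    rewrite /xi_sum big_distrl big_distrr /=; apply: eq_bigr => i _.
    have ip := ltn_ord i; rewrite /bump /= add1n -mulnA -expnSr mulnS expnD -mulnA.
    by rewrite subnS prednK // subn_gt0.
  rewrite big_ord_recr /= subnn muln1 mulnDl mulnC.
  rewrite -modnDmr -[in RHS]modnDmr; congr ((_ + _) %% _)%N.
  rewrite [(l * _)%N]mulnC expnM -modnMml -modnXm xi_exp_pred modnXm exp1n modnMml mul1n.
  by rewrite mulnC -modnMml xi_exp_pred modnMml mul1n.
have x0 : (0 < xi)%N.
  by rewrite lt0n; apply: contraL xp => /eqP->; rewrite /coprime gcd0n; lia.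
(* The two factors differ by [xi^i * (xi^(j-i) - 1)], which is prime to [p]. The pair (0,1) serves
   [l = 0] and the pair (1,l) serves [l > 1]. *)
have main i j : (i < j < p.-1)%N ->
    (xi ^ i * xi_sum l = xi ^ j * xi_sum l %[mod p ^ p])%N ->
    (p ^ p %| xi_sum l)%N.
  move=> /andP[ij jp] /esym/eqP.
  have -> : (xi ^ j = xi ^ i * xi ^ (j - i))%N by rewrite -expnD subnKC // ltnW.
  have y0 : (0 < xi ^ (j - i))%N by rewrite expn_gt0 x0.
  rewrite eqn_mod_dvd ?leq_mul2r ?leq_pmulr ?orbT // -mulnBl.
  rewrite -{2}[(xi ^ i)%N]muln1 -mulnBr -mulnA.
  rewrite Gauss_dvdr; last by rewrite coprimeXr // coprime_sym.
  rewrite Gauss_dvdr // coprime_pexpl // prime_coprime // -eqn_mod_dvd //.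
  by apply/eqP; apply: xi_exp_neq1; lia.
case: l lp l1 e => [|[|l]] // lp _ e in main *.
  by apply: (main 0%N 1%N) => //; lia.
by apply: (main 1%N l.+2) => //; lia.
Qed.

End Teichmueller.

Lemma coprime_small p d : prime p -> (0 < d < p)%N -> coprime d p.
Proof. by move=> pp /andP[d0 dp]; rewrite coprime_sym prime_coprime // gtnNdvd. Qed.

Lemma coprime_fact p d : prime p -> (d < p)%N -> coprime d`! p.
Proof.
move=> pp; elim: d => [|d IH] dp; first by rewrite coprime1n.
by rewrite factS coprimeMl coprime_small ?IH //; lia.
Qed.

(** * Division by small integers in a group of order [p^n], and the linear coefficient *)

Section PrimePower.
Variables (A : finZmodType) (p n k gamma : nat).
Hypotheses (pp : prime p) (cA : #|A| = (p ^ n)%N) (np : (n <= p)%N).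
Hypotheses (k1 : (1 < k)%N) (kp : (k < p)%N).
Hypothesis gP : primitive_root_mod gamma (p ^ p).
Implicit Types (x y z : A) (f g : nat -> A).

Let k0 : (0 < k)%N. Proof. exact: ltnW. Qed.
Let p2 : (2 < p)%N. Proof. exact: leq_ltn_trans kp. Qed.

Lemma mulrn_card x : x *+ (p ^ n) = 0.
Proof.
by rewrite -cA -cardsT -FinRing.Theory.zmodXgE; apply: expg_cardG; rewrite inE.
Qed.

Lemma mulrn_mod x m m' : (m = m' %[mod p ^ n])%N -> x *+ m = x *+ m'.
Proof.
move=> e; rewrite (divn_eq m (p ^ n)) (divn_eq m' (p ^ n)) e.
by rewrite !mulrnDr ![(_ * p ^ n)%N]mulnC !mulrnA mulrn_card !mul0rn.
Qed.

Lemma mulrn_dvd x m : (p ^ n %| m)%N -> x *+ m = 0.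
Proof. by move=> d; rewrite -[RHS](mulr0n x); apply: mulrn_mod; rewrite mod0n; apply/eqP. Qed.

Lemma inv_nat_mulD d : {morph @inv_nat_mul A d : x y / x + y}.
Proof. by move=> x y; rewrite /inv_nat_mul mulrnDl. Qed.

Lemma inv_nat_mul_morph (f : A -> A) d x : {morph f : x y / x + y} ->
  f (inv_nat_mul d x) = inv_nat_mul d (f x).
Proof. by move=> fD; rewrite /inv_nat_mul morph_addMn. Qed.

Lemma inv_nat_mulK d x : (0 < d)%N -> coprime d p -> inv_nat_mul d x *+ d = x.
Proof.
move=> d0 dp; rewrite /inv_nat_mul -mulrnA -[RHS]mulr1n cA.
case: egcdnP => // a b e _; rewrite e.
have /eqP-> : coprime d (p ^ n) by rewrite coprimeXr.
by rewrite mulrnDr [(b * _)%N]mulnC mulrnA mulrn_card mul0rn add0r.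
Qed.

Lemma mulrnI d x y : (0 < d)%N -> coprime d p -> x *+ d = y *+ d -> x = y.
Proof.
move=> d0 dp e; rewrite -(inv_nat_mulK x d0 dp) -(inv_nat_mulK y d0 dp).
by rewrite /inv_nat_mul -!mulrnA ![(_ * d)%N]mulnC !mulrnA e.
Qed.

Lemma inv_fact_mulK d x : (d < p)%N -> inv_nat_mul d`! x *+ d`! = x.
Proof. by move=> dp; rewrite inv_nat_mulK ?fact_gt0 ?coprime_fact. Qed.

Lemma inv_fact0 x : inv_nat_mul 0`! x = x.
Proof. by have := @inv_fact_mulK 0 x (prime_gt0 pp); rewrite fact0 mulr1n. Qed.

Lemma inv_nat_mul0 d : inv_nat_mul d (0 : A) = 0.
Proof. by rewrite /inv_nat_mul mul0rn. Qed.

Definition peval (a : nat -> A) (m : nat) : A := \sum_(l < k) a l *+ m ^ l.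

(* Averaging against the powers of [xi], a primitive (p-1)-st root of unity
   modulo p^p, extracts the coefficient of degree one. *)
Definition lincoef (f : nat -> A) : A :=
  let xi := (gamma ^ (p ^ p.-1))%N in
  - ((\sum_(i < p.-1) f (xi ^ i)%N *+ (xi ^ (p.-1 - i))) *+ (\sum_(i < n) p ^ i)%N).

Lemma lincoef_ext f g : f =1 g -> lincoef f = lincoef g.
Proof. by move=> e; rewrite /lincoef; under eq_bigr => i _ do rewrite e. Qed.

Lemma lincoefD f g : lincoef (fun m => f m + g m) = lincoef f + lincoef g.
Proof.
rewrite /lincoef; under eq_bigr => i _ do rewrite mulrnDl.
by rewrite big_split mulrnDl opprD.
Qed.

Lemma lincoef_morph (h : A -> A) f : {morph h : x y / x + y} ->
  lincoef (fun m => h (f m)) = h (lincoef f).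
Proof.
move=> hD; rewrite /lincoef (morph_addN hD) (morph_addMn hD) (morph_add_sum hD).
by under [in RHS]eq_bigr => i _ do rewrite (morph_addMn hD).
Qed.

Lemma lincoefN f : lincoef (fun m => - f m) = - lincoef f.
Proof. exact: lincoef_morph (@opprD _). Qed.

Lemma lincoef0 : lincoef (fun=> 0) = 0.
Proof. by rewrite /lincoef big1 ?mul0rn ?oppr0 // => i _; rewrite mul0rn. Qed.

Lemma lincoef_sum {I : Type} {r : seq I} {P : pred I} (F : I -> nat -> A) :
  lincoef (fun m => \sum_(i <- r | P i) F i m) = \sum_(i <- r | P i) lincoef (F i).
Proof.
elim: r => [|i r IH].
  by rewrite big_nil -[RHS]lincoef0; apply: lincoef_ext => m; rewrite big_nil.
rewrite big_cons -IH; case: ifP => Pi; last first.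
  by apply: lincoef_ext => m; rewrite big_cons Pi.
by rewrite -lincoefD; apply: lincoef_ext => m; rewrite big_cons Pi.
Qed.

(** The scalar [xi_sum l] vanishes for [l] other than 1 and is [p - 1] for [l = 1]; then [-(p - 1)(1
    + p + ... + p^(n-1)) = 1 - p^n] acts as 1. *)
Lemma lincoef_monomial x l : (l < p.-1)%N ->
  lincoef (fun m => x *+ m ^ l) = x *+ (l == 1%N).
Proof.
have dvd_pp : (p ^ n %| p ^ p)%N by rewrite dvdn_exp2l.
move=> lp; rewrite /lincoef; cbv zeta.
under eq_bigr => i _ do rewrite -mulrnA -expnM [(i * l)%N]mulnC.
rewrite sumrMnr -/(xi_sum p gamma l) -mulrnA.
have [->|l1] := eqVneq l 1%N; last first.
  rewrite /= mulr0n mulrn_dvd ?oppr0 // dvdn_mulr //; apply: dvdn_trans dvd_pp _.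
  exact: xi_sum0.
apply: (addIr (x *+ (xi_sum p gamma 1 * \sum_(i < n) p ^ i))).
rewrite addNr mulr1n -mulrS.
have -> : x *+ (xi_sum p gamma 1 * \sum_(i < n) p ^ i).+1 =
          x *+ (p.-1 * \sum_(i < n) p ^ i).+1.
  rewrite !mulrS; congr (_ + _); apply: mulrn_mod.
  rewrite -modnMml -[in RHS]modnMml; congr (_ * _ %% _)%N.
  by rewrite -(modn_dvdm _ dvd_pp) xi_sum1 // modn_dvdm.
by rewrite -predn_exp prednK ?mulrn_card // expn_gt0 prime_gt0.
Qed.

Lemma lincoef_peval a : lincoef (peval a) = a 1%N.
Proof.
rewrite (lincoef_sum (fun (l : 'I_k) m => a l *+ m ^ l)).
rewrite (bigD1 (Ordinal k1)) //= big1 ?addr0 => [|i ni].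
  by rewrite lincoef_monomial ?mulr1n //; lia.
rewrite lincoef_monomial; last by have := ltn_ord i; lia.
by rewrite (_ : (val i == 1%N) = false) //; apply: negbTE.
Qed.

(** * Graded polynomial functions *)

Section Filtered.
Variable T : nat -> {set A}.
Hypothesis FT : filtration k T.

(* The value at [m] of a polynomial divisible by the [i]-th power of the
   variable whose coefficient of degree [l] lies in [T l]. *)
Definition gpoly (i : nat) f := exists a : nat -> A,
  [/\ forall l, a l \in T l, forall l, (l < i)%N -> a l = 0 & f =1 peval a].

Lemma gpoly_ext i f g : f =1 g -> gpoly i f -> gpoly i g.
Proof. by move=> e [a [Ta a0 ef]]; exists a; split=> // m; rewrite -e ef. Qed.

Lemma gpoly_le i j f : (j <= i)%N -> gpoly i f -> gpoly j f.
Proof.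
move=> ji [a [Ta a0 ef]]; exists a; split=> // l lj.
by apply: a0; apply: leq_trans ji.
Qed.

Lemma gpoly0 i : gpoly i (fun=> 0).
Proof.
exists (fun=> 0); split=> // [l|m]; first exact: filt0 FT l.
by rewrite /peval big1 // => l _; rewrite mul0rn.
Qed.

Lemma gpolyD i f g : gpoly i f -> gpoly i g -> gpoly i (fun m => f m + g m).
Proof.
move=> [a [Ta a0 ef]] [b [Tb b0 eg]]; exists (fun l => a l + b l); split.
- by move=> l; apply: (filtD FT).
- by move=> l li; rewrite a0 ?b0 ?addr0.
by move=> m; rewrite ef eg -big_split; apply: eq_bigr => l _; rewrite mulrnDl.
Qed.

Lemma gpoly_morph i f (h : A -> A) : {morph h : x y / x + y} ->
  (forall l x, x \in T l -> h x \in T l) -> gpoly i f -> gpoly i (fun m => h (f m)).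
Proof.
move=> hD hT [a [Ta a0 ef]]; exists (fun l => h (a l)); split.
- by move=> l; apply: hT.
- by move=> l li; rewrite a0 // morph_add0.
move=> m; rewrite ef (morph_add_sum hD); apply: eq_bigr => l _.
by rewrite (morph_addMn hD).
Qed.

Lemma gpolyN i f : gpoly i f -> gpoly i (fun m => - f m).
Proof. by apply: gpoly_morph => [x y|l x]; [apply: opprD | apply: (filtN FT)]. Qed.

Lemma gpolyMn i f d : gpoly i f -> gpoly i (fun m => f m *+ d).
Proof.
by apply: (gpoly_morph (h := fun x => x *+ d)) => [x y|l x];
  [apply: mulrnDl | apply: (filtMn FT)].
Qed.

Lemma gpolyB i f g : gpoly i f -> gpoly i g -> gpoly i (fun m => f m - g m).
Proof. by move=> Pf /gpolyN; apply: gpolyD. Qed.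

Lemma gpoly_sum i I (r : seq I) (P : pred I) (F : I -> nat -> A) :
  (forall j, P j -> gpoly i (F j)) -> gpoly i (fun m => \sum_(j <- r | P j) F j m).
Proof.
move=> PF; elim: r => [|j r IH].
  by apply: gpoly_ext (gpoly0 i) => m; rewrite big_nil.
have [Pj|nPj] := boolP (P j).
  by apply: gpoly_ext (gpolyD (PF j Pj) IH) => m; rewrite big_cons Pj.
by apply: gpoly_ext IH => m; rewrite big_cons (negbTE nPj).
Qed.

Lemma gpoly_monomial i x : x \in T i -> gpoly i (fun m => x *+ m ^ i).
Proof.
move=> Tx; case: (ltnP i k) => ik; last first.
  by apply: gpoly_ext (gpoly0 i) => m; rewrite (filt_eq0 FT ik Tx) mul0rn.
exists (fun l => if l == i then x else 0); split.
- by move=> l; case: eqP => [->|_]; rewrite ?(filt0 FT).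
- by move=> l li; rewrite ltn_eqF.
move=> m; rewrite /peval (bigD1 (Ordinal ik)) //= eqxx big1 ?addr0 // => l nl.
by rewrite (_ : (val l == i) = false) ?mul0rn //; apply: negbTE.
Qed.

Lemma gpoly_const x : gpoly 0 (fun=> x).
Proof. by apply: gpoly_ext (gpoly_monomial (filtT0 FT x)). Qed.

Lemma gpoly_linear x : gpoly 1 (fun m => x *+ m).
Proof. exact: gpoly_monomial (filtT1 FT x). Qed.

Lemma gpoly_eq0 i f m : (k <= i)%N -> gpoly i f -> f m = 0.
Proof.
move=> ki [a [_ a0 ->]]; rewrite /peval big1 // => l _; rewrite a0 ?mul0rn //.
exact: leq_trans (ltn_ord l) ki.
Qed.

Lemma gpoly_split i f : gpoly i f ->
  exists2 x, x \in T i & gpoly i.+1 (fun m => f m - x *+ m ^ i).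
Proof.
move=> [a [Ta a0 ef]]; exists (a i) => //.
exists (fun l => if l == i then 0 else a l); split.
- by move=> l; case: eqP => // _; apply: (filt0 FT).
- by move=> l; rewrite ltnS leq_eqVlt; case: eqP => //= _; apply: a0.
move=> m; case: (ltnP i k) => ik; last first.
  rewrite (filt_eq0 FT ik (Ta i)) mul0rn subr0 ef; apply: eq_bigr => l _.
  by rewrite ltn_eqF // (leq_trans (ltn_ord l)).
rewrite ef /peval (bigD1 (Ordinal ik)) //= [_ *+ _ + _]addrC addrK.
rewrite [RHS](bigD1 (Ordinal ik)) //= eqxx mul0rn add0r.
by apply: eq_bigr => l nl; rewrite (_ : (val l == i) = false) //; apply: negbTE.
Qed.

Lemma peval0 (a : nat -> A) : peval a 0 = a 0.
Proof.
rewrite /peval (bigD1 (Ordinal k0)) //= expn0 mulr1n big1 ?addr0 // => l nl.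
by rewrite exp0n ?mulr0n // lt0n; apply: contraNneq nl => e; apply/eqP/val_inj.
Qed.

Lemma gpoly_val0 i f : (0 < i)%N -> gpoly i f -> f 0%N = 0.
Proof. by move=> i0 [a [_ a0 ->]]; rewrite peval0 a0. Qed.

Lemma gpoly_vanish f : gpoly 0 f -> f 0%N = 0 -> gpoly 1 f.
Proof.
move=> [a [Ta _ ef]] f0; exists a; split=> // -[|//] _.
by rewrite -peval0 -ef.
Qed.

Lemma lincoef_gpoly f a : f =1 peval a -> lincoef f = a 1%N.
Proof. by move=> /lincoef_ext->; apply: lincoef_peval => //; lia. Qed.

Lemma lincoef_gpoly2 f : gpoly 2 f -> lincoef f = 0.
Proof. by move=> [a [_ a0 /lincoef_gpoly->]]; apply: a0. Qed.

Lemma lincoef_linear (x : A) : lincoef (fun m => x *+ m) = x.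
Proof.
rewrite -[RHS]mulr1n -(lincoef_monomial x (l := 1)) ?expn1; last by lia.
by apply: lincoef_ext => m; rewrite expn1.
Qed.

Lemma lincoef_const (x : A) : lincoef (fun=> x) = 0.
Proof.
by rewrite -[RHS](mulr0n x) -(lincoef_monomial x (l := 0)) //; lia.
Qed.

Lemma gpoly_taylor f : gpoly 0 f -> gpoly 2 (fun m => f m - f 0%N - lincoef f *+ m).
Proof.
move=> Pf; have [x0 _ P1] := gpoly_split Pf.
have e0 : f 0%N = x0.
  by apply/eqP; rewrite -subr_eq0; have := gpoly_val0 _ P1; rewrite expn0 mulr1n => ->.
have [x1 _ P2] := gpoly_split P1.
have e1 : lincoef f = x1.
  have := lincoef_gpoly2 P2; rewrite lincoefD lincoefD !lincoefN.
  rewrite !(lincoef_monomial); try lia.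
  rewrite mulr0n oppr0 addr0 mulr1n.
  by move/eqP; rewrite subr_eq0 => /eqP.
by apply: gpoly_ext P2 => m; rewrite e0 e1 expn0 expn1.
Qed.

(** Expanding [(t + m)^l] only lowers degrees, and [T] decreases, so the coefficient of [m^j] stays
    in [T j]. *)
Lemma gpoly_shift f t : gpoly 0 f -> gpoly 0 (fun m => f (t + m)%N).
Proof.
move=> [a [Ta _ ef]].
apply: (@gpoly_ext _ (fun m => \sum_(l < k) \sum_(j < l.+1)
          (a l *+ (t ^ (l - j) * 'C(l, j))) *+ m ^ j)); last first.
  apply: gpoly_sum => l _; apply: gpoly_sum => j _.
  apply: (@gpoly_le j) => //; apply: gpoly_monomial; apply: (filtMn FT).
  by apply: (filt_le FT) (Ta l); rewrite -ltnS.
move=> m; rewrite ef; apply: eq_bigr => l _.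
rewrite expnDn -sumrMnr; apply: eq_bigr => j _; rewrite -mulrnA; congr (_ *+ _).
by rewrite mulnCA mulnA.
Qed.

(** This makes the linear coefficient after translation by [t] the formal derivative at [t]: only
    the term [l t^(l-1) m] of [(t + m)^l] counts. *)
Lemma lincoef_shift (a : nat -> A) t : (forall l, a l \in T l) ->
  lincoef (fun m => peval a (t + m)) = peval (fun l => a l.+1 *+ l.+1) t.
Proof.
move=> Ta; have dmono l : (l < k)%N ->
    lincoef (fun m => a l *+ (t + m) ^ l) = a l *+ (l * t ^ l.-1).
  case: l => [|l] lk; first by rewrite mul0n -[RHS](lincoef_const (a 0)).
  rewrite (lincoef_ext (g := fun m =>
    \sum_(j < l.+2) (a l.+1 *+ (t ^ (l.+1 - j) * 'C(l.+1, j))) *+ m ^ j)); last first.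
    move=> m; rewrite expnDn -sumrMnr; apply: eq_bigr => j _.
    by rewrite -mulrnA; congr (_ *+ _); lia.
  rewrite (lincoef_sum (fun (j : 'I_l.+2) m =>
    (a l.+1 *+ (t ^ (l.+1 - j) * 'C(l.+1, j))) *+ m ^ j)).
  rewrite (bigD1 (inord 1)) //= big1 ?addr0 => [|j nj].
    rewrite (lincoef_monomial) inordK //; last by lia.
    by rewrite // bin1 subSS subn0 mulr1n mulnC.
  rewrite (lincoef_monomial); try (have := ltn_ord j; lia).
  rewrite (_ : (val j == 1%N) = false) //; apply: contraNF nj => /eqP e.
  by apply/eqP/val_inj; rewrite /= inordK.
rewrite (lincoef_sum (fun (l : 'I_k) m => a l *+ (t + m) ^ l)).
rewrite (eq_bigr (fun l : 'I_k => a l *+ (l * t ^ l.-1))); last first.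
  by move=> l _; apply: dmono.
rewrite /peval -(prednK k0) big_ord_recl mul0n mulr0n add0r.
rewrite [RHS]big_ord_recr /= (prednK k0) (filt_eq0 FT (leqnn k) (Ta k)).
by rewrite !mul0rn addr0; apply: eq_bigr => l _; rewrite mulrnA.
Qed.

(* The differential equation [f' = h o f], solved by comparing coefficients:
   the j-th derivative of [f] is [iter j h \o f]. *)
Lemma gpoly_ode f (h : A -> A) : gpoly 0 f -> {morph h : x y / x + y} ->
  (forall t, lincoef (fun m => f (t + m)%N) = h (f t)) ->
  f 1%N = \sum_(l < k) inv_nat_mul l`! (iter l h (f 0%N)).
Proof.
move=> [a [Ta _ ef]] hD ode.
have der j t : peval (fun l => a (l + j)%N *+ (l + j) ^_ j) t = iter j h (f t).
  elim: j t => [|j IH] t.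
    by rewrite ef; apply: eq_bigr => l _; rewrite addn0 ffactn0 mulr1n.
  rewrite iterSr -ode -(lincoef_morph _ (iter_morph_add j hD)).
  rewrite -(lincoef_ext (fun m => IH (t + m)%N)) lincoef_shift; last first.
    by move=> l; apply: (filtMn FT); apply: (filt_le FT) (Ta _); apply: leq_addr.
  apply: eq_bigr => l _; rewrite addSnnS -mulrnA.
  by rewrite -!mulrnA ffactnSr; congr (_ *+ _); lia.
rewrite ef /peval; apply: eq_bigr => l _; rewrite exp1n mulr1n.
have lp : (l < p)%N by apply: ltn_trans kp.
(* At [t = 0] the formula [der] says that [l!] times the coefficient [a l] is [iter l h (f 0)], and
   [l!] is prime to [p]. *)
apply: (mulrnI (d := l`!)); rewrite ?fact_gt0 ?coprime_fact //.
by rewrite inv_fact_mulK // -der peval0 add0n ffactnn.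
Qed.

(** * Flows of a pre-Lie product *)

Section Flows.
Variable mul : A -> A -> A.
Hypotheses (mulDl : forall x y z, mul (x + y) z = mul x z + mul y z)
           (mulDr : forall x y z, mul x (y + z) = mul x y + mul x z)
           (mulT : graded_op T mul).
Local Notation P := gpoly.
Local Notation W := (flowW n mul).
Local Notation Om := (flowOmega n mul).
Local Notation E := (expL n mul).

Let mulxD x : {morph mul x : y z / y + z}. Proof. by move=> y z; apply: mulDr. Qed.
Let mulDx y : {morph mul^~ y : x z / x + z}. Proof. by move=> x z; apply: mulDl. Qed.
Let mul0x y : mul 0 y = 0. Proof. exact: morph_add0 (mulDx y). Qed.
Let mulx0 x : mul x 0 = 0. Proof. exact: morph_add0 (mulxD x). Qed.

Lemma gpoly_mul i j f g : P i f -> P j g -> P (i + j) (fun m => mul (f m) (g m)).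
Proof.
move=> [a [Ta a0 ef]] [b [Tb b0 eg]].
apply: (@gpoly_ext _ (fun m => \sum_(l < k) \sum_(q < k)
         (mul (a l) (b q)) *+ m ^ (l + q))).
  move=> m; rewrite ef eg /peval (morph_add_sum (mulDx _)); apply: eq_bigr => l _.
  rewrite (morph_add_sum (mulxD _)); apply: eq_bigr => q _.
  by rewrite (morph_addMn (mulxD _)) (morph_addMn (mulDx _)) -mulrnA expnD.
apply: gpoly_sum => l _; apply: gpoly_sum => q _.
case: (ltnP l i) => li.
  by apply: gpoly_ext (gpoly0 _) => m; rewrite a0 // mul0x mul0rn.
case: (ltnP q j) => qj.
  by apply: gpoly_ext (gpoly0 _) => m; rewrite b0 // mulx0 mul0rn.
by apply: gpoly_le (leq_add li qj) _; apply: gpoly_monomial => //; apply: mulT.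
Qed.

Lemma gpoly_iter i j f g r : P i f -> P j g ->
  P (r * i + j) (fun m => iter r (mul (f m)) (g m)).
Proof.
by move=> Pf Pg; elim: r => //= r IH; rewrite mulSn -addnA; apply: gpoly_mul.
Qed.

(** Leibniz rule: taking [mul (f m) (g 0)] and [mul (f 0) (lincoef g) *+ m] away from the product
    leaves a multiple of [m^2]. *)
Lemma lincoef_mul f g : P 0 f -> P 0 g ->
  lincoef (fun m => mul (f m) (g m)) = mul (lincoef f) (g 0%N) + mul (f 0%N) (lincoef g).
Proof.
move=> Pf Pg; have Pg2 := gpoly_taylor Pg.
have Pf1 : P 1 (fun m => f m - f 0%N).
  by apply: gpoly_vanish; rewrite ?subrr //; apply: gpolyB => //; apply: gpoly_const.
have R : P 2 (fun m => mul (f m) (g m - g 0%N - lincoef g *+ m) +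
                       mul (f m - f 0%N) (lincoef g *+ m)).
  apply: gpolyD => //; first exact: gpoly_mul Pf Pg2.
  exact: gpoly_mul Pf1 (gpoly_linear (lincoef g)).
have := lincoef_gpoly2 R.
rewrite (lincoef_ext (g := fun m => mul (f m) (g m) -
   (mul (f m) (g 0%N) + mul (f 0%N) (lincoef g) *+ m))); last first.
  move=> m; rewrite !(morph_addB (mulxD _)) (morph_addB (mulDx _)).
  rewrite addrA subrK -(morph_addMn (mulxD _)) opprD addrA //.
rewrite lincoefD lincoefN lincoefD (lincoef_linear).
rewrite (lincoef_morph f (mulDx (g 0%N))).
by move/eqP; rewrite subr_eq0 => /eqP.
Qed.

Lemma iter_mulT i a j x : a \in T i -> x \in T j ->
  forall r, iter r (mul a) x \in T (r * i + j)%N.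
Proof. exact: graded_iter mulT. Qed.

Lemma iter_mul_ge_k a x j : (k <= j)%N -> iter j (mul a) x = 0.
Proof.
move=> kj; have := iter_mulT (filtT1 FT a) (filtT0 FT x) j.
by rewrite muln1 addn0 => /(filt_eq0 FT); apply.
Qed.

(** Weights only kill iterates from [k] on, while the definitions cut off in terms of [n]; the chain
    of kernels in a group of order [p^n] bridges the gap. *)
Lemma iter_mul_ge_n a x j : (n <= j)%N -> iter j (mul a) x = 0.
Proof.
move/subnK <-; rewrite iterD.
rewrite (nilpotent_iter_bound pp cA (mulxD a) (M := k)).
  by rewrite (morph_add0 (iter_morph_add _ (mulxD a))).
by move=> y; apply: iter_mul_ge_k.
Qed.

Lemma expLE a x : E a x = \sum_(j < k) inv_nat_mul j`! (iter j (mul a) x).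
Proof.
apply: (@big_ord_trunc _ (fun j => inv_nat_mul j`! (iter j (mul a) x))) => j h.
  by rewrite iter_mul_ge_n ?inv_nat_mul0 // ltnW.
by rewrite iter_mul_ge_k ?inv_nat_mul0.
Qed.

Lemma flowWE a : W a = \sum_(j < k) inv_nat_mul j.+1`! (iter j (mul a) a).
Proof.
apply: (@big_ord_trunc _ (fun j => inv_nat_mul j.+1`! (iter j (mul a) a))) => j h.
  by rewrite iter_mul_ge_n ?inv_nat_mul0 // ltnW.
by rewrite iter_mul_ge_k ?inv_nat_mul0.
Qed.

Lemma expLD a : {morph E a : x y / x + y}.
Proof.
move=> x y; rewrite /expL -big_split; apply: eq_bigr => j _ /=.
by rewrite (iter_morph_add _ (mulxD a)) inv_nat_mulD.
Qed.

Lemma gpoly_inv_nat_mul i d f : P i f -> P i (fun m => inv_nat_mul d (f m)).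
Proof. exact: gpolyMn. Qed.

Lemma filt_inv_nat_mul i d x : x \in T i -> inv_nat_mul d x \in T i.
Proof. exact: (filtMn FT). Qed.

Lemma flowW_tail a :
  W a - a = \sum_(j < k.-1) inv_nat_mul j.+2`! (iter j.+1 (mul a) a).
Proof.
rewrite flowWE -[in LHS](prednK k0) big_ord_recl /=.
by rewrite (inv_fact0) [a + _]addrC addrK.
Qed.

Lemma expL_tail a x :
  E a x - x = \sum_(j < k.-1) inv_nat_mul j.+1`! (iter j.+1 (mul a) x).
Proof.
rewrite expLE -[in LHS](prednK k0) big_ord_recl /=.
by rewrite (inv_fact0) [x + _]addrC addrK.
Qed.

Lemma iter_mul_diff i x y j : x - y \in T i ->
  iter j.+1 (mul x) x - iter j.+1 (mul y) y \in T i.+1.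
Proof.
move=> Txy.
have h r : iter r (mul x) x - iter r (mul y) y \in T i ->
    iter r.+1 (mul x) x - iter r.+1 (mul y) y \in T i.+1.
  move=> Tr /=.
  have -> : mul x (iter r (mul x) x) - mul y (iter r (mul y) y) =
     mul x (iter r (mul x) x - iter r (mul y) y) + mul (x - y) (iter r (mul y) y).
    by rewrite (morph_addB (mulxD _)) (morph_addB (mulDx _)) addrA subrK.
  apply: (filtD FT); first exact: (mulT (filtT1 FT x) Tr).
  by rewrite -addn1; apply: mulT Txy (filtT1 FT _).
elim: j => [|j IH]; first exact: h.
by apply: h; apply: (filt_le FT) IH.
Qed.

(** All terms of [W] beyond the identity contain a multiplication, which raises the weight of a
    difference; this is the contraction hypothesis for injectivity. *)
Lemma flowW_diff i x y : x - y \in T i -> (W x - W y) - (x - y) \in T i.+1.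
Proof.
move=> Txy.
have -> : (W x - W y) - (x - y) = (W x - x) - (W y - y).
  by rewrite !opprB [y - x]addrC addrACA [- W y + y]addrC.
rewrite !flowW_tail -sumrB; apply: (filt_sum FT) => j _.
by rewrite -mulrnBl; apply: (filtMn FT); apply: iter_mul_diff.
Qed.

Lemma flowW_inj : injective W.
Proof. exact: (filt_contraction_inj FT flowW_diff). Qed.

Lemma flowOmegaK : cancel Om W.
Proof.
(* An injection of a finite set into itself is onto, so the default value in [flowOmega] never
   occurs. *)
move=> x; rewrite /flowOmega; case: pickP => [b /eqP //|no].
by have /codomP[b e] := injF_onto flowW_inj x; have := no b; rewrite e eqxx.
Qed.

Lemma flowWK : cancel W Om.
Proof. by move=> a; apply: flowW_inj; rewrite flowOmegaK. Qed.

Lemma flowW0 : W 0 = 0.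
Proof.
by rewrite /flowW big1 // => j _; case: j => -[|j] _ /=; rewrite ?mul0x inv_nat_mul0.
Qed.

Lemma expL0x x : E 0 x = x.
Proof.
apply/eqP; rewrite -subr_eq0 expL_tail big1 // => j _.
by rewrite /= mul0x inv_nat_mul0.
Qed.

Lemma flowOmega0 : Om 0 = 0.
Proof. by rewrite -{1}flowW0 flowWK. Qed.

Lemma flowOmegaT i x : x \in T i -> Om x \in T i.
Proof.
move=> Tx; suff h j : (j <= i)%N -> Om x \in T j by apply: h.
elim: j => [|j IH] ji; first exact: (filtT0 FT).
have := @flowW_diff j (Om x) 0; rewrite flowW0 !subr0 flowOmegaK => h.
rewrite -[Om x](subKr x); apply: (filtB FT); first exact: (filt_le FT) ji Tx.
by apply: h; apply: IH; apply: ltnW.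
Qed.

Lemma expL_inj a : injective (E a).
Proof.
apply: (filt_contraction_inj FT) => i x y Txy.
have ED := @expLD a.
rewrite -(morph_addB ED) expL_tail; apply: (filt_sum FT) => j _.
apply: filt_inv_nat_mul.
apply: (filt_le FT) (iter_mulT (filtT1 FT a) Txy j.+1).
by rewrite muln1 addSn ltnS leq_addl.
Qed.

Lemma gpoly_expL f g : P 0 f -> P 0 g -> P 0 (fun m => E (f m) (g m)).
Proof.
move=> Pf Pg; apply: (@gpoly_ext _ (fun m =>
   \sum_(j < k) inv_nat_mul j`! (iter j (mul (f m)) (g m)))).
  by move=> m; rewrite expLE.
apply: gpoly_sum => j _; apply: gpoly_inv_nat_mul.
by have := gpoly_iter j Pf Pg; rewrite muln0.
Qed.

(** Each term of the tail contains [f m] at least twice; for [i = 1] this makes [W (f m)] and [f m]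
    agree to first order. *)
Lemma gpoly_flowW_tail i f : P i f -> P (i + i) (fun m => W (f m) - f m).
Proof.
move=> Pf; apply: (@gpoly_ext _ (fun m =>
   \sum_(j < k.-1) inv_nat_mul j.+2`! (iter j.+1 (mul (f m)) (f m)))).
  by move=> m; rewrite flowW_tail.
apply: gpoly_sum => j _; apply: gpoly_inv_nat_mul.
by apply: (gpoly_le (i := j.+1 * i + i)); [lia | apply: gpoly_iter].
Qed.

Lemma gpoly_flowW f : P 0 f -> P 0 (fun m => W (f m)).
Proof.
move=> Pf; have := gpolyD (gpoly_flowW_tail Pf) Pf.
by apply: gpoly_ext => m; rewrite subrK.
Qed.

(* [Om (f m)] is the limit, reached after [k] steps, of the iteration
   [u |-> f m - (W u - u)]. *)
Lemma gpoly_flowOmega f : P 0 f -> P 0 (fun m => Om (f m)).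
Proof.
move=> Pf; pose s r m := iter r (fun u => f m - (W u - u)) 0.
have Ps r : P 0 (s r).
  elim: r => [|r IH]; first exact: (gpoly0 0).
  by apply: gpolyB => //; apply: gpoly_flowW_tail IH.
have lim r m : s r m - Om (f m) \in T r.
  elim: r => [|r IH]; first exact: (filtT0 FT).
  have := filtN FT (flowW_diff IH); rewrite flowOmegaK !opprB.
  have -> : s r.+1 m = f m + s r m - W (s r m) by rewrite /s /= opprB addrA.
  by rewrite addrACA [_ + f m]addrC [- _ - W _]addrC !addrA.
apply: gpoly_ext (Ps k) => m; apply/eqP; rewrite -subr_eq0; apply/eqP.
exact: (filt_eq0 FT (leqnn k) (lim k m)).
Qed.

(** * Derivatives of exponentials of left multiplications, and the group law of flows *)

Section PreLie.
Hypothesis preLie : is_preLie mul.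

Definition preLie_ad x y := mul x y - mul y x.
Local Notation ad := preLie_ad.

(** The pre-Lie identity as a commutator rule: [[L_x, L_y]] is left multiplication by [ad x y]. *)
Lemma preLie_adE x y z : mul x (mul y z) = mul (ad x y) z + mul y (mul x z).
Proof.
case: preLie => _ [_ /(_ x y z)] /eqP; rewrite subr_eq => /eqP e.
have -> : mul (ad x y) z = - mul y (mul x z) + mul x (mul y z).
  rewrite /ad (morph_addB (mulDx z)) e.
  by rewrite [X in X + _ - _]addrC -!addrA [mul (mul y x) z + _]addrC subrK.
by rewrite addrAC addNr add0r.
Qed.

Section ExpDerivative.
Variables (u v : A) (g : A -> nat -> A) (d : nat -> A).
Hypotheses (gD : forall q, {morph g^~ q : x y / x + y})
           (gT : forall i q x, x \in T i -> g x q \in T (i + q)%N)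
           (ug : forall x q, mul u (g x q) = g (ad u x) q + g x q.+1)
           (d0 : d 0 = 0) (dS : forall j, d j.+1 = g v j + mul u (d j)).

(* [g x q] stands for [x L_u^q], and [d j] for the derivative of [L_u^j] in the
   direction [v]: the right logarithmic derivative of [exp L_u] is again a left
   multiplication. *)
Definition dexp := \sum_(q < k) inv_nat_mul q.+1`! (iter q (ad u) v).

(** By [ug], every [L_u] standing left of [v] is moved to its right at the cost of an [ad u];
    collecting the terms is Pascal's rule. *)
Lemma d_binomial j :
  d j = \sum_(q < j) g (iter q (ad u) v) (j - q.+1) *+ 'C(j, q.+1).
Proof.
elim: j => [|j IH]; first by rewrite big_ord0.
rewrite dS IH (morph_add_sum (mulxD u)).
under eq_bigr => q _ do rewrite (morph_addMn (mulxD u)) ug mulrnDl.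
rewrite big_split /=.
rewrite [RHS](eq_bigr (fun q : 'I_j.+1 =>
   g (iter q (ad u) v) (j.+1 - q.+1) *+ 'C(j, q) +
   g (iter q (ad u) v) (j.+1 - q.+1) *+ 'C(j, q.+1))); last first.
  by move=> q _; rewrite binS addnC mulrnDr.
rewrite big_split /= big_ord_recl /= bin0 mulr1n subSS subn0 -addrA; congr (_ + _).
congr (_ + _).
rewrite big_ord_recr /= bin_small // mulr0n addr0; apply: eq_bigr => q _.
by rewrite subSS -subSn // .
Qed.

Lemma iter_adT q : iter q (ad u) v \in T q.+1.
Proof.
elim: q => [|q IH] /=; first exact: (filtT1 FT).
apply: (filtB FT); first by rewrite -add1n; apply: mulT (filtT1 FT u) IH.
by rewrite -addn1; apply: mulT IH (filtT1 FT u).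
Qed.

Lemma d_ge_k j : (k <= j)%N -> d j = 0.
Proof.
move=> kj; rewrite d_binomial big1 // => q _.
have := gT (j - q.+1)%N (iter_adT q); rewrite subnKC // => /(filt_eq0 FT kj)->.
by rewrite mul0rn.
Qed.

(** Since [C(j,q+1)/j! = 1/((q+1)!(j-q-1)!)], the sum over [j] becomes a double sum over [q] and
    [m = j-q-1]. Its triangular range extends to a square, the new terms having weight at least [k],
    and the square sum factors. *)
Lemma sum_dexp :
  \sum_(j < k) inv_nat_mul j`! (d j) = \sum_(m < k) inv_nat_mul m`! (g dexp m).
Proof.
pose G q m := inv_nat_mul m`! (inv_nat_mul q.+1`! (g (iter q (ad u) v) m)).
have G0 q m : (k <= q.+1 + m)%N -> G q m = 0.
  by move=> h; rewrite /G (filt_eq0 FT h (gT m (iter_adT q))) !inv_nat_mul0.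
transitivity (\sum_(q < k) \sum_(m < k) G q m); last first.
  rewrite exchange_big; apply: eq_bigr => m _ /=.
  rewrite /dexp (morph_add_sum (gD m)) (morph_add_sum (inv_nat_mulD _)).
  by apply: eq_bigr => q _; rewrite /G (inv_nat_mul_morph _ _ (gD m)).
transitivity (\sum_(j < k) \sum_(q < k | (q < j)%N) G q (j - q.+1)%N).
  apply: eq_bigr => j _; have jk := ltn_ord j.
  rewrite d_binomial (morph_add_sum (inv_nat_mulD _)).
  rewrite (big_ord_widen k (fun q => inv_nat_mul j`!
    (g (iter q (ad u) v) (j - q.+1) *+ 'C(j, q.+1)))); last by apply: ltnW.
  apply: eq_bigr => q qj; rewrite /G.
  have jp : (j < p)%N by apply: ltn_trans kp.
  have qp : (q.+1 < p)%N by apply: leq_trans jp.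
  have mp : (j - q.+1 < p)%N by apply: leq_ltn_trans jp; apply: leq_subr.
  apply: (mulrnI (d := j`!)); rewrite ?fact_gt0 ?coprime_fact //.
  rewrite inv_fact_mulK // -(bin_fact qj).
  set z := g _ _; set y := inv_nat_mul _ z; set x := inv_nat_mul _ y.
  have ex : x *+ (j - q.+1)`! = y by apply: inv_fact_mulK.
  have ey : y *+ q.+1`! = z by apply: inv_fact_mulK.
  clearbody x.
  have -> : ('C(j, q.+1) * (q.+1`! * (j - q.+1)`!) =
             (j - q.+1)`! * (q.+1`! * 'C(j, q.+1)))%N by lia.
  by rewrite mulrnA ex mulrnA ey.
rewrite (exchange_big_dep xpredT) //=; apply: eq_bigr => q _.
transitivity (\sum_(0 + q.+1 <= j < k) G q (j - q.+1)%N).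
  by rewrite add0n big_geq_mkord.
rewrite big_addn big_mkord (eq_bigr (fun m : 'I_(k - q.+1) => G q m)) => [|m _]; last first.
  by rewrite addnK.
apply: (@big_ord_trunc _ (G q)) => m h; apply: G0; lia.
Qed.

End ExpDerivative.

Lemma lincoef_expL_const f c : P 0 f ->
  lincoef (fun m => E (f m) c) = mul (dexp (f 0%N) (lincoef f)) (E (f 0%N) c).
Proof.
move=> Pf; set u := f 0%N.
pose d j := lincoef (fun m => iter j (mul (f m)) c).
rewrite (lincoef_ext (g := fun m =>
   \sum_(j < k) inv_nat_mul j`! (iter j (mul (f m)) c))); last first.
  by move=> m; rewrite expLE.
rewrite (lincoef_sum (fun (j : 'I_k) m => inv_nat_mul j`! (iter j (mul (f m)) c))).
rewrite (eq_bigr (fun j : 'I_k => inv_nat_mul j`! (d j))); last first.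
  by move=> j _; rewrite -(lincoef_morph _ (inv_nat_mulD _)).
rewrite (@sum_dexp u (lincoef f) (fun v q => mul v (iter q (mul u) c))) //.
- rewrite expLE (morph_add_sum (mulxD _)); apply: eq_bigr => j _.
  by rewrite (inv_nat_mul_morph _ _ (mulxD _)).
- move=> i q x Tx; apply: mulT => //.
  by have := iter_mulT (filtT1 FT u) (filtT0 FT c) q; rewrite muln1 addn0.
- by move=> x q; rewrite preLie_adE.
- exact: lincoef_const.
move=> j; rewrite /d /= lincoef_mul //.
by have := gpoly_iter j Pf (gpoly_const c); apply: gpoly_le.
Qed.

(** The same rule at the vector 1 of the unital extension, as [W = e^L(1) - 1]. Since 1 lies outside
    [A], [L_u^q(1)] is written [L_u^(q-1)(u)] and the case [q = 0] is separate. *)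
Lemma lincoef_flowW f : P 0 f ->
  let w := dexp (f 0%N) (lincoef f) in
  lincoef (fun m => W (f m)) = w + mul w (W (f 0%N)).
Proof.
move=> Pf w; set u := f 0%N.
pose d j := if j is j'.+1 then lincoef (fun m => iter j' (mul (f m)) (f m)) else 0.
pose g v q := if q is q'.+1 then mul v (iter q' (mul u) u) else v.
have gT i q x : x \in T i -> g x q \in T (i + q)%N.
  move=> Tx; case: q => [|q] /=; first by rewrite addn0.
  apply: mulT => //; have := iter_mulT (filtT1 FT u) (filtT1 FT u) q.
  by rewrite muln1 addn1.
have gD q : {morph g^~ q : x y / x + y}.
  by move=> x y; case: q => [|q] //=; rewrite mulDl.
have ug x q : mul u (g x q) = g (ad u x) q + g x q.+1.
  case: q => [|q] /=; first by rewrite /ad subrK.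
  by rewrite preLie_adE.
have dS j : d j.+1 = g (lincoef f) j + mul u (d j).
  case: j => [|j] /=; first by rewrite mulx0 addr0.
  rewrite lincoef_mul // /d.
  by have := gpoly_iter j Pf Pf; apply: gpoly_le.
have := sum_dexp gD gT ug erefl dS; rewrite -/w => e.
transitivity (\sum_(m < k) inv_nat_mul m`! (g w m)).
  rewrite -e (lincoef_ext (g := fun m =>
     \sum_(j < k) inv_nat_mul j.+1`! (iter j (mul (f m)) (f m)))); last first.
    by move=> m; rewrite flowWE.
  rewrite (lincoef_sum (fun (j : 'I_k) m =>
     inv_nat_mul j.+1`! (iter j (mul (f m)) (f m)))).
  rewrite (eq_bigr (fun j : 'I_k => inv_nat_mul j.+1`! (d j.+1))); last first.
    by move=> j _; rewrite -(lincoef_morph _ (inv_nat_mulD _)).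
  have dk := d_ge_k gT ug erefl dS.
  transitivity (\sum_(j < k.+1) inv_nat_mul j`! (d j)).
    by rewrite [RHS]big_ord_recl inv_nat_mul0 add0r.
  by rewrite big_ord_recr /= -/(d k) dk // inv_nat_mul0 addr0.
rewrite -[in LHS](prednK k0) big_ord_recl /= inv_fact0; congr (_ + _).
rewrite flowWE -[in RHS](prednK k0) big_ord_recr /=.
have := iter_mulT (filtT1 FT u) (filtT1 FT u) k.-1.
rewrite muln1 addn1 (prednK k0) => /(filt_eq0 FT (leqnn k))->.
rewrite inv_nat_mul0 addr0 (morph_add_sum (mulxD _)); apply: eq_bigr => j _.
by rewrite (inv_nat_mul_morph _ _ (mulxD _)).
Qed.

Lemma dexp_comm u v : mul u v = mul v u -> dexp u v = v.
Proof.
move=> uv; rewrite /dexp -(prednK k0) big_ord_recl /= inv_fact0 big1 ?addr0 // => j _.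
rewrite /bump /= -iterS iterSr /ad uv subrr (_ : iter j _ 0 = 0) ?inv_nat_mul0 //.
by elim: (val j) => //= i ->; rewrite mulx0 mul0x subrr.
Qed.

(** Substituting [z = - mul z y] into itself raises the weight of [z] by one each time. *)
Lemma add_mul_inj y z : z + mul z y = 0 -> z = 0.
Proof.
move/eqP; rewrite addr_eq0 => /eqP e.
suff h i : z \in T i by apply: (filt_eq0 FT (leqnn k) (h k)).
elim: i => [|i IH]; first exact: (filtT0 FT).
by rewrite e; apply: (filtN FT); rewrite -addn1; apply: mulT IH (filtT1 FT y).
Qed.

Lemma gpoly_line a t : P 0 (fun m => a *+ (t + m)).
Proof.
apply: (gpoly_shift (f := fun m => a *+ m)).
exact: (gpoly_le _ (gpoly_linear a)).
Qed.

Lemma lincoef_line a t : lincoef (fun m => a *+ (t + m)) = a.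
Proof.
rewrite (lincoef_ext (g := fun m => a *+ t + a *+ m)) => [|m]; last first.
  by rewrite mulrnDr.
by rewrite lincoefD lincoef_const lincoef_linear add0r.
Qed.

Lemma dexp_line a t : dexp (a *+ t) a = a.
Proof.
by apply: dexp_comm; rewrite (morph_addMn (mulxD _)) (morph_addMn (mulDx _)).
Qed.

Lemma lincoef_flowW_line a t :
  lincoef (fun m => W (a *+ (t + m))) = a + mul a (W (a *+ t)).
Proof. by rewrite (lincoef_flowW (gpoly_line a t)) lincoef_line dexp_line addn0. Qed.

Lemma lincoef_expL_line a x t :
  lincoef (fun m => E (a *+ (t + m)) x) = mul a (E (a *+ t) x).
Proof. by rewrite (lincoef_expL_const x (gpoly_line a t)) lincoef_line dexp_line addn0. Qed.

(* Along the curve [y m = W (m a) + E (m a) x], which satisfies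
   [y' = a + mul a y], the operator [E (Om (y m))] solves [X' = L_a X]. *)
Lemma expL_flow a x c : E (Om (W a + E a x)) c = E a (E (Om x) c).
Proof.
pose y m := W (a *+ m) + E (a *+ m) x.
have Py : P 0 y.
  have Pa := gpoly_line a 0.
  by apply: gpolyD; [apply: gpoly_flowW | apply: gpoly_expL => //; apply: gpoly_const].
have Dy t : lincoef (fun m => y (t + m)%N) = a + mul a (y t).
  by rewrite lincoefD lincoef_flowW_line lincoef_expL_line /y mulDr addrA.
pose u m := Om (y m).
have Pu : P 0 u by apply: gpoly_flowOmega.
have Wu m : W (u m) = y m by apply: flowOmegaK.
(* Differentiating [W (u m) = y m] in two ways gives [w + mul w (y t) = a + mul a (y t)]. *)
have wu t : dexp (u (t + 0)%N) (lincoef (fun m => u (t + m)%N)) = a.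
  set w := dexp _ _; apply/eqP; rewrite -subr_eq0; apply/eqP.
  apply: (@add_mul_inj (y t)).
  have := lincoef_flowW (gpoly_shift t Pu); rewrite -/w /=.
  rewrite (lincoef_ext (g := fun m => y (t + m)%N)) ?Dy ?addn0 ?Wu; last first.
    by move=> m; rewrite Wu.
  by move=> e; rewrite (morph_addB (mulDx _)) addrACA -e -opprD subrr.
pose G m := E (u m) c.
have PG : P 0 G by apply: gpoly_expL => //; apply: gpoly_const.
have := gpoly_ode PG (mulxD a); rewrite /G => -> => [|t].
  by rewrite -(expLE a) /u /y mulr0n flowW0 expL0x add0r.
by rewrite lincoef_expL_const ?wu ?addn0 //; apply: gpoly_shift.
Qed.

Lemma expL_flow_circ a b c :
  E (Om (flows_circ n mul a b)) c = E (Om a) (E (Om b) c).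
Proof. by rewrite -expL_flow flowOmegaK. Qed.

Lemma flows_circ_brace : is_brace (flows_circ n mul).
Proof.
split; last first.
  by move=> a b c; rewrite /flows_circ expLD addrA -[LHS]addrA; congr (_ + _); apply: addrC.
have assoc a b c : flows_circ n mul a (flows_circ n mul b c) =
                   flows_circ n mul (flows_circ n mul a b) c.
  by rewrite {1 2 3}/flows_circ expL_flow_circ expLD addrA.
have rid a : flows_circ n mul a 0 = a.
  by rewrite /flows_circ (morph_add0 (expLD _)) addr0.
have lid a : flows_circ n mul 0 a = a.
  by rewrite /flows_circ flowOmega0 expL0x add0r.
split=> //; exists 0; split=> [a|a]; first by rewrite lid rid.
(* [E (Om b)] is injective on a finite set, so [- b] is a value; a right inverse of a right inverse
   of [a] is then [a] itself. *)
have rinv b : exists c, flows_circ n mul b c = 0.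
  have /codomP[c e] := injF_onto (expL_inj (a := Om b)) (- b).
  by exists c; rewrite /flows_circ -e subrr.
have [b ab] := rinv a; have [c bc] := rinv b; exists b; split=> //.
by have -> : a = c by rewrite -[a]rid -bc assoc ab lid.
Qed.

End PreLie.

Lemma flows_star a b : brace_star (flows_circ n mul) a b = E (Om a) b - b.
Proof. by rewrite /brace_star /flows_circ [a + _]addrC addrK. Qed.

Lemma flows_star_graded : graded_op T (brace_star (flows_circ n mul)).
Proof.
move=> i j x y Tx Ty; rewrite flows_star expL_tail; apply: (filt_sum FT) => r _.
apply: filt_inv_nat_mul.
apply: (filt_le FT) (iter_mulT (flowOmegaT Tx) Ty r.+1); lia.
Qed.

(** To first order in [m], [Om (a *+ m)] is [a *+ m] and [E u b - b] is [mul u b]. *)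
Lemma assoc_odot_flows a b : assoc_odot p n gamma (flows_circ n mul) a b = mul a b.
Proof.
pose u m := Om (a *+ m).
transitivity (lincoef (fun m => E (u m) b - b)).
  (* Unfolded, [assoc_odot] is literally the linear coefficient of [m |-> (m a) * b]. *)
  rewrite -[LHS]/(lincoef (fun m => brace_star (flows_circ n mul) (a *+ m) b)).
  by apply: lincoef_ext => m; rewrite -flows_star.
have Pa : P 0 (fun m => a *+ m) by apply: (gpoly_le _ (gpoly_linear a)).
have Pu : P 1 u.
  by apply: gpoly_vanish; [apply: gpoly_flowOmega | rewrite /u mulr0n flowOmega0].
have Du : lincoef u = a.
  have := lincoef_gpoly2 (gpoly_flowW_tail Pu); rewrite lincoefD lincoefN.
  rewrite (lincoef_ext (g := fun m => a *+ m)) ?lincoef_linear; last first.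
    by move=> m; rewrite flowOmegaK.
  by move/eqP; rewrite subr_eq0 => /eqP.
have Pu0 := gpoly_le (leq0n _) Pu.
have P2 : P 2 (fun m => \sum_(j < k.-2) inv_nat_mul j.+2`! (iter j.+2 (mul (u m)) b)).
  apply: gpoly_sum => j _; apply: gpoly_inv_nat_mul.
  by apply: (gpoly_le _ (gpoly_iter j.+2 Pu (gpoly_const b))); lia.
have e m : E (u m) b - b = mul (u m) b +
     \sum_(j < k.-2) inv_nat_mul j.+2`! (iter j.+2 (mul (u m)) b).
  have k2 : k.-1 = k.-2.+1 by lia.
  rewrite expL_tail.
  transitivity (\sum_(j < k.-2.+1) inv_nat_mul j.+1`! (iter j.+1 (mul (u m)) b)).
    by rewrite -k2.
  by rewrite big_ord_recl; congr (_ + _); apply: inv_fact0.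
rewrite (lincoef_ext e) lincoefD (lincoef_gpoly2 P2) addr0.
by rewrite (lincoef_morph u (mulDx b)) Du.
Qed.

End Flows.

Lemma assoc_odot_graded circ : graded_op T (brace_star circ) ->
  graded_op T (assoc_odot p n gamma circ).
Proof.
move=> starT i j x y Tx Ty; rewrite /assoc_odot /assoc_dot.
apply: (filtN FT); apply: (filtMn FT); apply: (filt_sum FT) => r _.
by apply: (filtMn FT); apply: starT => //; apply: (filtMn FT).
Qed.

(** * The linear part of a brace *)

Section Brace.
Variable circ : A -> A -> A.
Hypothesis brace : is_brace circ.
Local Notation star := (brace_star circ).
Local Notation dot := (assoc_odot p n gamma circ).
Hypothesis starT : graded_op T star.

Let circA a b c : circ a (circ b c) = circ (circ a b) c.
Proof. by case: brace => -[]. Qed.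

Lemma circE a b : circ a b = a + b + star a b.
Proof. by rewrite /brace_star addrC -[_ - a - b]addrA -opprD subrK. Qed.

Lemma starDr a : {morph star a : b c / b + c}.
Proof.
move=> b c; case: brace => _ /(_ a b c) e.
have {}e : circ a (b + c) = circ a b + circ a c - a by rewrite -e addrK.
by rewrite /brace_star e opprD [RHS]addrACA [X in _ = X + _]addrACA !addrA.
Qed.

Lemma circx0 a : circ a 0 = a.
Proof. by rewrite circE addr0 (morph_add0 (starDr a)) addr0. Qed.

Lemma circ0x a : circ 0 a = a.
Proof.
case: brace => -[_ [e [eP _]]] _.
by have [e0 _] := eP 0; have [+ _] := eP a; rewrite circx0 in e0; rewrite e0.
Qed.

Lemma star0x b : star 0 b = 0.
Proof. by rewrite /brace_star circ0x subr0 subrr. Qed.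

(** Associativity of [circ] in the form [lam_(a o b) = lam_a lam_b], where [lam_a = id + star a]. *)
Lemma star_circ a b c : star (circ a b) c = star a c + star b c + star a (star b c).
Proof.
have := circA a b c; rewrite [circ a _]circE [circ b c]circE [circ (circ a b) c]circE.
rewrite [circ a b]circE (starDr a (b + c)) (starDr a b) => /esym e.
apply: (addrI (a + b + star a b + c)); rewrite {}e.
move: (star a b) (star a c) (star b c) (star a (star b c)) => s1 s2 s3 s4.
rewrite -!addrA; do 2!congr (_ + _).
rewrite [RHS]addrCA; congr (_ + _); rewrite addrCA; congr (_ + _).
by rewrite addrCA.
Qed.

(* The inverse of [1 + star x], as a geometric series; hence
   [circ x (star_inv x v) = x + v]. *)
Definition star_inv x v := \sum_(j < k) iter j (fun y => - star x y) v.

Lemma star_invK x v : star_inv x v + star x (star_inv x v) = v.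
Proof.
rewrite /star_inv; set s := fun y => - star x y.
have s0 : iter k s v = 0.
  suff h j : iter j s v \in T j by apply: (filt_eq0 FT (leqnn k) (h k)).
  elim: j => [|j IH] /=; first exact: (filtT0 FT).
  by apply: (filtN FT); rewrite -add1n; apply: starT (filtT1 FT x) IH.
have e : star x (\sum_(j < k) iter j s v) = - \sum_(j < k) iter j.+1 s v.
  by rewrite (morph_add_sum (starDr x)) -sumrN; apply: eq_bigr => j _; rewrite /s /= opprK.
have e' : \sum_(j < k) iter j s v = v + \sum_(j < k) iter j.+1 s v.
  transitivity (\sum_(j < k.+1) iter j s v); last by rewrite big_ord_recl.
  by rewrite big_ord_recr /= s0 addr0.
by rewrite e {1}e' addrK.
Qed.

(** The substitute for additivity on the left: [x + v] is [circ x (star_inv x v)], to which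
    [star_circ] applies. *)
Lemma star_addl x v c :
  star (x + v) c = star x c + star (star_inv x v) c + star x (star (star_inv x v) c).
Proof. by rewrite -star_circ circE -addrA star_invK. Qed.

(* Iterated finite differences of order at most [r], along a variable of
   weight [i], lie in the expected term of the filtration. *)
Fixpoint fdiff i r w f : Prop :=
  (forall m, f m \in T w) /\
  if r is r'.+1 then fdiff i r' (w + i) (fun m => f m.+1 - f m) else True.

Lemma fdiff_ext i r w f g : f =1 g -> fdiff i r w f -> fdiff i r w g.
Proof.
elim: r w f g => [|r IH] w f g e /= [fT df]; split=> //; try by move=> m; rewrite -e.
by apply: IH df => m; rewrite !e.
Qed.

Lemma fdiff_val i r w f m : fdiff i r w f -> f m \in T w.
Proof. by case: r => [|r] []. Qed.

Lemma fdiffW i r w f : fdiff i r.+1 w f -> fdiff i r w f.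
Proof. by elim: r w f => [|r IH] w f [fT df]; split=> //; apply: IH. Qed.

Lemma fdiff_le i r w w' f : (w' <= w)%N -> fdiff i r w f -> fdiff i r w' f.
Proof.
elim: r w w' f => [|r IH] w w' f le [fT df]; split=> //;
  try by move=> m; apply: (filt_le FT le).
by apply: IH df; rewrite leq_add2r.
Qed.

Lemma fdiffD i r w f g : fdiff i r w f -> fdiff i r w g ->
  fdiff i r w (fun m => f m + g m).
Proof.
elim: r w f g => [|r IH] w f g [fT df] [gT dg]; split=> //;
  try by move=> m; apply: (filtD FT).
by apply: fdiff_ext (IH _ _ _ df dg) => m; rewrite opprD addrACA.
Qed.

Lemma fdiffN i r w f : fdiff i r w f -> fdiff i r w (fun m => - f m).
Proof.
elim: r w f => [|r IH] w f [fT df]; split=> //; try by move=> m; apply: (filtN FT).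
by apply: fdiff_ext (IH _ _ df) => m; rewrite opprB addrC opprK.
Qed.

Lemma fdiff0 i r w : fdiff i r w (fun=> 0).
Proof.
elim: r w => [|r IH] w; split=> //; try by move=> m; apply: (filt0 FT).
by apply: fdiff_ext (IH _) => m; rewrite subrr.
Qed.

Lemma fdiff_const i r w c : c \in T w -> fdiff i r w (fun=> c).
Proof.
move=> Tc; case: r => [|r] //=; split=> //.
by apply: fdiff_ext (fdiff0 _ _ _) => m; rewrite subrr.
Qed.

Lemma fdiff_sum i r w I (s : seq I) (F : I -> nat -> A) :
  (forall j, fdiff i r w (F j)) -> fdiff i r w (fun m => \sum_(j <- s) F j m).
Proof.
move=> FF; elim: s => [|j s IH].
  by apply: fdiff_ext (fdiff0 _ _ _) => m; rewrite big_nil.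
by apply: fdiff_ext (fdiffD (FF j) IH) => m; rewrite big_cons.
Qed.

Lemma fdiff_shift i r w f : fdiff i r w f -> fdiff i r w (fun m => f m.+1).
Proof.
elim: r w f => [|r IH] w f [fT df]; split=> //.
exact: (IH _ _ df).
Qed.

Lemma fdiff_linear i r a : a \in T i -> fdiff i r 0 (fun m => a *+ m).
Proof.
move=> Ta; case: r => [|r] /=; split=> //; try by move=> m; apply: (filtT0 FT).
by apply: fdiff_ext (fdiff_const _ _ Ta) => m; rewrite mulrSr addrC addKr.
Qed.

(** A difference of [star (f m) (g m)] has a part from the difference of [g] and, by [star_addl],
    two parts containing [d m], of weight [v + i]. All three are covered by induction on the order
    [r]. *)
Lemma fdiff_star i r v w f g : fdiff i r v f -> fdiff i r w g ->
  fdiff i r (v + w) (fun m => star (f m) (g m)).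
Proof.
elim: r v w f g => [|r IH] v w f g Ff Fg; split=> //;
  try by move=> m; apply: starT; [apply: fdiff_val Ff | apply: fdiff_val Fg].
pose d m := star_inv (f m) (f m.+1 - f m).
have Ff' := fdiffW Ff; have Fg' := fdiffW Fg.
have Fd : fdiff i r (v + i) d.
  apply: fdiff_sum => j; elim: {j}(val j) => [|j IHj] /=; first by case: Ff.
  by apply: fdiffN; apply: fdiff_le (IH _ _ _ _ Ff' IHj); apply: leq_addl.
have F1 : fdiff i r (v + w + i) (fun m => star (f m.+1) (g m.+1 - g m)).
  by rewrite -addnA; apply: IH; [apply: fdiff_shift | case: Fg].
have F2 : fdiff i r (v + w + i) (fun m => star (d m) (g m)).
  by rewrite addnAC; apply: IH.
have F3 : fdiff i r (v + w + i) (fun m => star (f m) (star (d m) (g m))).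
  apply: fdiff_le (IH _ _ _ _ Ff' F2); exact: leq_addl.
apply: fdiff_ext (fdiffD F1 (fdiffD F2 F3)) => m.
rewrite (morph_addB (starDr _)) -addrA; congr (_ + _).
rewrite -[f m.+1](subrK (f m)) [f m.+1 - f m + f m]addrC star_addl -/(d m).
by rewrite -[star (f m) (g m) + _ + _]addrA opprD subrK.
Qed.

(** * Newton expansion, and polynomiality of the brace operation *)

Definition fwd_diff f m := f m.+1 - f m.

Lemma newton_expansion f m :
  f m = \sum_(l < m.+1) iter l fwd_diff f 0%N *+ 'C(m, l).
Proof.
elim: m f => [|m IH] f; first by rewrite big_ord_recl big_ord0 bin0 addr0.
have -> : f m.+1 = fwd_diff f m + f m by rewrite /fwd_diff subrK.
rewrite (IH (fwd_diff f)) (IH f).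
rewrite [RHS]big_ord_recl bin0 mulr1n.
rewrite [X in _ + X]big_ord_recl bin0 mulr1n addrCA; congr (_ + _).
rewrite [RHS](eq_bigr (fun l : 'I_m.+1 =>
   iter l.+1 fwd_diff f 0%N *+ 'C(m, l) + iter l.+1 fwd_diff f 0%N *+ 'C(m, l.+1))).
  rewrite big_split; congr (_ + _).
    by apply: eq_bigr => l _; rewrite iterSr.
  by rewrite [RHS]big_ord_recr /= bin_small // mulr0n addr0.
by move=> l _; rewrite [lift _ _]/= /bump binS addnC mulrnDr.
Qed.

Lemma fdiff_iter i w f l m : (forall r, fdiff i r w f) ->
  iter l fwd_diff f m \in T (l * i + w)%N.
Proof.
move=> Ff; suff: forall r, fdiff i r (l * i + w) (iter l fwd_diff f).
  by move/(_ 0%N)/fdiff_val; apply.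
elim: l => // l IH r /=; rewrite mulSn -addnA addnC.
by have [] := IH r.+1.
Qed.

(** With [x = m^i], the recursion [(l+2) C(x,l+2) = x C(x,l+1) - (l+1) C(x,l+1)] trades a binomial
    for powers of [m]. Division by [l+2] is possible below [p]; from there on [b] vanishes by
    weight. *)
Lemma gpoly_binomial i j l b : (0 < i)%N -> b \in T (l.+1 * i + j)%N ->
  gpoly (i + j) (fun m => b *+ ('C(m ^ i, l.+1) * m ^ j)).
Proof.
move=> i0; elim: l j b => [|l IH] j b Tb.
  rewrite mul1n in Tb.
  by apply: gpoly_ext (gpoly_monomial Tb) => m; rewrite bin1 expnD.
case: (ltnP l.+2 p) => lp; last first.
  apply: gpoly_ext (gpoly0 _) => m; rewrite (filt_eq0 FT _ Tb) ?mul0rn //.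
  by nia.
pose b' := inv_nat_mul l.+2 b.
have Tb' : b' \in T (l.+2 * i + j)%N by apply: filt_inv_nat_mul.
have eb : b' *+ l.+2 = b by apply: inv_nat_mulK; rewrite ?coprime_small.
have P1 : gpoly (i + j) (fun m => b' *+ ('C(m ^ i, l.+1) * m ^ (i + j))).
  apply: (@gpoly_le (i + (i + j))); first exact: leq_addl.
  by apply: IH; rewrite addnA -mulSnr.
have P2 : gpoly (i + j) (fun m => b' *+ ('C(m ^ i, l.+1) * m ^ j) *+ l.+1).
  apply: gpolyMn; apply: IH; apply: (filt_le FT) Tb'.
  by rewrite leq_add2r leq_mul2r leqnSn orbT.
clearbody b'; apply: gpoly_ext (gpolyB P1 P2) => m.
rewrite -eb -!mulrnA; apply/eqP; rewrite subr_eq -mulrnDr; apply/eqP; congr (_ *+ _).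
have e : (m ^ i * 'C(m ^ i, l.+1) = l.+2 * 'C(m ^ i, l.+2) + l.+1 * 'C(m ^ i, l.+1))%N.
  rewrite mul_bin_left -mulnDl; case: (leqP l.+1 (m ^ i)) => h; first by rewrite subnK.
  by rewrite bin_small ?muln0.
rewrite expnD; move: e; move: (m ^ i)%N (m ^ j)%N => x y e.
by rewrite mulnA [('C(_, _) * x)%N]mulnC e; lia.
Qed.

(** Newton expansion of [s |-> (s a) * b] at [s = m^i]: the [l]-th difference has weight [l i + j],
    and the constant term vanishes because [star 0 b = 0], which yields the factor [m^i]. *)
Lemma gpoly_star_monomial i j a b : a \in T i -> b \in T j ->
  gpoly (i + j) (fun m => star (a *+ m ^ i) (b *+ m ^ j)).
Proof.
move=> Ta Tb; have [i0|i0] := posnP i.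
  have Tab : star a b \in T (i + j)%N by apply: starT.
  apply: gpoly_ext (gpoly_monomial Tab) => m.
  by rewrite i0 expn0 mulr1n (morph_addMn (starDr _)).
pose f s := star (a *+ s) b; pose c l := iter l fwd_diff f 0%N.
have Ff r : fdiff i r j f.
  by apply: (@fdiff_star i r 0 j); [apply: fdiff_linear | apply: fdiff_const].
have cT l : c l \in T (l * i + j)%N by apply: fdiff_iter.
have c00 : c 0%N = 0 by rewrite /c /f /= mulr0n star0x.
have c0 l : (k <= l)%N -> c l = 0.
  move=> kl; apply: (filt_eq0 FT _ (cT l)); nia.
apply: (@gpoly_ext _ (fun m => \sum_(l < k.-1) c l.+1 *+ ('C(m ^ i, l.+1) * m ^ j))).
  move=> m; rewrite (morph_addMn (starDr _)) -/(f (m ^ i)%N).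
  have -> : f (m ^ i)%N = \sum_(l < k) c l *+ 'C(m ^ i, l).
    rewrite newton_expansion.
    apply: (@big_ord_trunc _ (fun l => c l *+ 'C(m ^ i, l))).
    - by move=> l ml; rewrite bin_small.
    - by move=> l kl; rewrite c0 // mul0rn.
  rewrite -[in RHS](prednK k0) big_ord_recl c00 mul0rn add0r.
  by rewrite -sumrMnl; apply: eq_bigr => l _; rewrite mulrnA.
by apply: gpoly_sum => l _; apply: gpoly_binomial.
Qed.

Lemma gpoly_star_monomiall i j a g : a \in T i -> gpoly j g ->
  gpoly (i + j) (fun m => star (a *+ m ^ i) (g m)).
Proof.
move=> Ta [b [Tb b0 eg]].
apply: (@gpoly_ext _ (fun m => \sum_(l < k) star (a *+ m ^ i) (b l *+ m ^ l))).
  by move=> m; rewrite eg /peval (morph_add_sum (starDr _)).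
apply: gpoly_sum => l _; case: (ltnP l j) => lj.
  by apply: gpoly_ext (gpoly0 _) => m; rewrite b0 // mul0rn (morph_add0 (starDr _)).
by apply: (gpoly_le _ (gpoly_star_monomial Ta (Tb l))); rewrite leq_add2l.
Qed.

(* Peel off the leading monomial of [f], by [star_addl]. *)
Lemma gpoly_star i j f g : gpoly i f -> gpoly j g ->
  gpoly (i + j) (fun m => star (f m) (g m)).
Proof.
have [d] := ubnP (k - i)%N; elim: d i j f g => // d IH i j f g di Pf Pg.
case: (ltnP i k) => ik; last first.
  by apply: gpoly_ext (gpoly0 _) => m; rewrite (gpoly_eq0 _ ik Pf) star0x.
have [a Ta Pv] := gpoly_split Pf.
set v := (fun m => f m - a *+ m ^ i) in Pv.
pose v' m := star_inv (a *+ m ^ i) (v m).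
have Pv' : gpoly i.+1 v'.
  apply: gpoly_sum => r _; elim: {r}(val r) => [|r IHr] //=.
  apply: gpolyN; apply: (gpoly_le _ (gpoly_star_monomiall Ta IHr)); exact: leq_addl.
have P2 : gpoly (i + j) (fun m => star (v' m) (g m)).
  by apply: (@gpoly_le (i.+1 + j)); [rewrite addSn | apply: IH => //; lia].
have P3 := gpoly_le (leq_addl _ _) (gpoly_star_monomiall Ta P2).
apply: gpoly_ext (gpolyD (gpolyD (gpoly_star_monomiall Ta Pg) P2) P3) => m.
by rewrite -star_addl /v addrC subrK.
Qed.

Lemma gpoly_star_inv i f g : gpoly 0 f -> gpoly i g ->
  gpoly i (fun m => star_inv (f m) (g m)).
Proof.
move=> Pf Pg; apply: gpoly_sum => r _; elim: {r}(val r) => [|r IHr] //=.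
by apply: gpolyN; apply: (gpoly_star Pf IHr).
Qed.

Lemma star_invD x : {morph star_inv x : v w / v + w}.
Proof.
move=> v w; rewrite /star_inv -big_split; apply: eq_bigr => j _ /=.
by apply: iter_morph_add => {}v {}w; rewrite starDr opprD.
Qed.

Lemma star_inv0 v : star_inv 0 v = v.
Proof. by have := star_invK 0 v; rewrite star0x addr0. Qed.

(** * The pre-Lie product as linear part of the brace *)

(** After [star_addl] splits off the linear term of [f], its remainder and [g m - g 0] contribute
    only multiples of [m^2]. *)
Lemma lincoef_star f g : gpoly 1 f -> gpoly 0 g ->
  lincoef (fun m => star (f m) (g m)) = dot (lincoef f) (g 0%N).
Proof.
move=> Pf Pg; set x := lincoef f.
have Pv : gpoly 2 (fun m => f m - x *+ m).
  have := gpoly_taylor (gpoly_le (leq0n _) Pf).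
  by rewrite (gpoly_val0 _ Pf) //; apply: gpoly_ext => m; rewrite subr0.
have Px := gpoly_linear x.
pose v' m := star_inv (x *+ m) (f m - x *+ m).
have Pv' : gpoly 2 v' by apply: gpoly_star_inv Pv; apply: gpoly_le Px.
have Pg1 : gpoly 1 (fun m => g m - g 0%N).
  by apply: gpoly_vanish; rewrite ?subrr //; apply: gpolyB (gpoly_const _).
have P2 := gpoly_star Pv' Pg.
have P3 := gpoly_le (leq_addl _ _) (gpoly_star Px P2).
have P4 := gpoly_star Px Pg1.
have := lincoef_gpoly2 (gpolyD P4 (gpolyD P2 P3)).
rewrite (lincoef_ext (g := fun m => star (f m) (g m) - star (x *+ m) (g 0%N))); last first.
  move=> m; rewrite (morph_addB (starDr _)) -[f m](subrK (x *+ m)) [_ + x *+ m]addrC.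
  by rewrite star_addl addrAC !addrA.
by rewrite lincoefD lincoefN => /eqP; rewrite subr_eq0 => /eqP.
Qed.

Let dotT : graded_op T dot. Proof. exact: assoc_odot_graded. Qed.

Lemma assoc_odotDr x : {morph dot x : y z / y + z}.
Proof.
move=> y z; rewrite -[LHS]/(lincoef (fun m => star (x *+ m) (y + z))).
rewrite (lincoef_ext (g := fun m => star (x *+ m) y + star (x *+ m) z)) => [|m].
  by rewrite lincoefD.
exact: starDr.
Qed.

(** The curve [(m x) o (m y)] has linear part [x + y], and by [star_circ] its action on [z] is the
    sum of the two actions up to degree two. *)
Lemma assoc_odotDl z : {morph dot^~ z : x y / x + y}.
Proof.
move=> x y; have Px := gpoly_linear x; have Py := gpoly_linear y.
have Pz := gpoly_const z.
have Pxy := gpoly_star Px Py.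
have P1 : gpoly 1 (fun m => circ (x *+ m) (y *+ m)).
  apply: gpoly_ext (gpolyD (gpolyD Px Py) (gpoly_le (leqnSn 1) Pxy)) => m.
  by rewrite circE.
have P3 := gpoly_star Px (gpoly_star Py Pz).
have <- : lincoef (fun m => circ (x *+ m) (y *+ m)) = x + y.
  rewrite (lincoef_ext (fun m => circE (x *+ m) (y *+ m))) lincoefD.
  by rewrite (lincoef_gpoly2 Pxy) addr0 lincoefD !lincoef_linear.
rewrite -(lincoef_star P1 Pz).
rewrite (lincoef_ext (g := fun m => star (x *+ m) z + star (y *+ m) z +
   star (x *+ m) (star (y *+ m) z))) => [|m]; last exact: star_circ.
by rewrite lincoefD (lincoef_gpoly2 P3) addr0 lincoefD.
Qed.

(* Differentiate [circ (m y) x = circ x (star_inv x (m y + star (m y) x))] at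
   [m = 0]. *)
Lemma star_ode x y c : let w := star_inv x (y + dot y x) in
  dot w c + star x (dot w c) = dot y (c + star x c).
Proof.
move=> w; have Py := gpoly_linear y.
have Pyx : gpoly 1 (fun m => star (y *+ m) x) := gpoly_star Py (gpoly_const x).
pose psi m := star_inv x (y *+ m + star (y *+ m) x).
have Ppsi : gpoly 1 psi by apply: gpoly_star_inv (gpoly_const x) (gpolyD Py Pyx).
have Dpsi : lincoef psi = w.
  rewrite (lincoef_morph _ (star_invD x)) lincoefD lincoef_linear.
  by congr (star_inv x (_ + _)).
have e m : star (y *+ m) (c + star x c) = star (psi m) c + star x (star (psi m) c).
  have h := star_circ (y *+ m) x c; apply: (addIr (star x c)).
  rewrite starDr addrAC -h.
  have -> : circ (y *+ m) x = circ x (psi m).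
    by rewrite !circE -[RHS]addrA star_invK [RHS]addrA; congr (_ + _); apply: addrC.
  by rewrite star_circ -[LHS]addrA; apply: addrC.
rewrite -[RHS]/(lincoef (fun m => star (y *+ m) (c + star x c))) (lincoef_ext e).
rewrite lincoefD (lincoef_morph (fun m => star (psi m) c) (starDr x)).
by rewrite (lincoef_star Ppsi (gpoly_const c)) Dpsi.
Qed.

(* The coefficient of degree one of [star_ode] at [m x]. *)
Lemma assoc_odot_preLie : is_preLie dot.
Proof.
split; first by move=> x y z; apply: assoc_odotDl.
split; first by move=> x y z; apply: assoc_odotDr.
suff h x y c : dot y (dot x c) = dot (dot y x - dot x y) c + dot x (dot y c).
  move=> x y z; apply/eqP; rewrite subr_eq (h y x z) (morph_addB (assoc_odotDl z)).
  by rewrite [X in _ == X]addrC [X in _ == X]addrACA subrK subrr addr0.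
have Px := gpoly_linear x; have Px0 := gpoly_le (leq0n 1) Px.
pose th m := star_inv (x *+ m) (y + dot y (x *+ m)).
have Pyx : gpoly 0 (fun m => y + dot y (x *+ m)).
  apply: gpolyD (gpoly_const y) _.
  apply: gpoly_ext (gpoly_le (leq0n 1) (gpoly_linear (dot y x))) => m.
  by rewrite (morph_addMn (assoc_odotDr y)).
have Pth : gpoly 0 th by apply: gpoly_star_inv.
have th0 : th 0%N = y.
  by rewrite /th mulr0n star_inv0 (morph_add0 (assoc_odotDr y)) addr0.
(* Linear coefficients of [th m + star (x *+ m) (th m) = y + dot y x *+ m], which is [star_invK]. *)
have Dth : lincoef th = dot y x - dot x y.
  have := lincoef_star Px Pth; rewrite lincoef_linear th0 => <-; apply/eqP.
  rewrite -subr_eq opprK -lincoefD; apply/eqP.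
  rewrite (lincoef_ext (g := fun m => y + dot y x *+ m)) => [|m].
    by rewrite lincoefD lincoef_const lincoef_linear add0r.
  by rewrite star_invK (morph_addMn (assoc_odotDr y)).
have Pthc : gpoly 0 (fun m => dot (th m) c).
  apply: (gpoly_morph (assoc_odotDl c)) Pth => l z Tz.
  by rewrite -[l]addn0; apply: dotT (filtT0 FT c).
transitivity (lincoef (fun m => dot y (c + star (x *+ m) c))).
  by rewrite (lincoef_morph _ (assoc_odotDr y)) lincoefD lincoef_const add0r.
rewrite -(lincoef_ext (fun m => star_ode (x *+ m) y c)) lincoefD.
rewrite (lincoef_morph th (assoc_odotDl c)) Dth (lincoef_star Px Pthc).
by rewrite lincoef_linear th0.
Qed.

(** It suffices that [id + star (W u)] is the exponential of left multiplication by [u]; [gpoly_ode]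
    gives this along the curve [W (t u)]. *)
Lemma flows_assoc_odot a b : flows_circ n dot a b = circ a b.
Proof.
have dDl x y z : dot (x + y) z = dot x z + dot y z by apply: assoc_odotDl.
have dDr x y z : dot x (y + z) = dot x y + dot x z by apply: assoc_odotDr.
suff h u c : c + star (flowW n dot u) c = expL n dot u c.
  rewrite /flows_circ -h (flowOmegaK dDl dDr dotT) circE -addrA; congr (_ + _).
pose y m := flowW n dot (u *+ m).
have Py : gpoly 0 y.
  by apply: (gpoly_flowW dDl dDr dotT); apply: gpoly_le (gpoly_linear u).
have y0 : y 0%N = 0 by rewrite /y mulr0n (flowW0 dDl).
pose X m := c + star (y m) c.
have Pc := gpoly_const c.
have PX : gpoly 0 X by apply: gpolyD Pc (gpoly_star Py Pc).
have -> : c + star (flowW n dot u) c = X 1%N by rewrite /X /y mulr1n.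
rewrite (gpoly_ode PX (assoc_odotDr u)) => [|t].
  by rewrite /X y0 star0x addr0 (expLE dDr dotT).
(* Chosen so that [y (t + m) = circ (y t) (v m)]; the linear part of [v] then has the shape required
   by [star_ode]. *)
pose v m := star_inv (y t) (y (t + m)%N - y t).
have Pyt := gpoly_const (y t).
have Pv : gpoly 1 v.
  apply: (gpoly_star_inv Pyt); apply: gpoly_vanish; last by rewrite addn0 subrr.
  exact: gpolyB (gpoly_shift t Py) Pyt.
have Dv : lincoef v = star_inv (y t) (u + dot u (y t)).
  rewrite (lincoef_morph _ (star_invD _)) lincoefD lincoefN lincoef_const subr0.
  by rewrite /y (lincoef_flowW_line dDl dDr dotT assoc_odot_preLie).
rewrite /X -star_ode -Dv.
rewrite (lincoef_ext (g := fun m => X t + (star (v m) c + star (y t) (star (v m) c)))).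
  rewrite lincoefD lincoef_const add0r lincoefD (lincoef_morph _ (starDr (y t))).
  by rewrite (lincoef_star Pv Pc).
move=> m; rewrite /X -{1}[y (t + m)%N](subrK (y t)) [_ + y t]addrC star_addl.
by rewrite !addrA.
Qed.

End Brace.

End Filtered.
End PrimePower.

(** * Equality of the strong series, and the correspondence *)

(** Each operation is graded for the strong series of the other, being a combination of its iterates
    or of its values, so minimality gives both inclusions. Hence the nilpotency index is
    preserved. *)
Lemma strong_ser_flows (A : finZmodType) (p n k gamma : nat) (mul : A -> A -> A) :
  prime p -> #|A| = (p ^ n)%N -> (n <= p)%N -> (1 < k < p)%N ->
  primitive_root_mod gamma (p ^ p) -> is_preLie mul ->
  strong_ser mul k = [set 0] ->
  strong_ser (brace_star (flows_circ n mul)) =1 strong_ser mul.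
Proof.
move=> pp cA np /andP[k1 kp] gP [mulDl [mulDr _]] nil.
have FT := strong_ser_filtration nil.
have mulT := @strong_ser_graded A mul.
have starT := flows_star_graded pp cA np k1 kp FT mulDl mulDr mulT.
have sub i : strong_ser (brace_star (flows_circ n mul)) i \subset strong_ser mul i.
  by apply: strong_ser_min => // [{}i|{}i j x y _ _];
     [apply: strong_ser_subgroup | apply: starT].
have nil' : strong_ser (brace_star (flows_circ n mul)) k = [set 0].
  apply/eqP; rewrite eqEsubset -{1}nil sub sub1set.
  by have /addsubgroupP[] := strong_ser_subgroup (brace_star (flows_circ n mul)) k.
have FS := strong_ser_filtration nil'.
move=> i; apply/eqP; rewrite eqEsubset sub /=.
apply: strong_ser_min => // [{}i|{}i j x y _ _ Tx Ty]; first exact: strong_ser_subgroup.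
rewrite -(assoc_odot_flows pp cA np k1 kp gP FT mulDl mulDr mulT).
exact: (assoc_odot_graded p n gamma FS (@strong_ser_graded _ _) Tx Ty).
Qed.

Lemma strong_ser_ext (A : finZmodType) (op op' : A -> A -> A) :
  op =2 op' -> strong_ser op =1 strong_ser op'.
Proof.
suff sub (f g : A -> A -> A) : f =2 g -> forall i, strong_ser f i \subset strong_ser g i.
  by move=> e i; apply/eqP; rewrite eqEsubset !sub.
move=> e m; apply: strong_ser_min => // [i|i j x y _ _]; first exact: strong_ser_subgroup.
by rewrite e; apply: strong_ser_graded.
Qed.

(** For [k] at most 1 the terms of index [k] and [k.-1] are both the whole group, so they cannot
    differ. *)
Lemma nil_index_gt1 (A : finZmodType) (op : A -> A -> A) k :
  has_nil_index op k -> (1 < k)%N.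
Proof. by case: k => [|[|k]] // [e ne]; case: ne. Qed.

Theorem theorem1 (p k n : nat) (A : finZmodType) (gamma : nat) :
  prime p -> (k + 1 <= p)%N -> (n + 2 <= p)%N -> #|A| = (p ^ n)%N ->
  primitive_root_mod gamma (p ^ p) ->
  (forall mul : A -> A -> A,
      is_nilpotent_preLie_index mul k ->
      is_snilpotent_brace_index (flows_circ n mul) k /\
      (forall a b, assoc_odot p n gamma (flows_circ n mul) a b = mul a b)) /\
  (forall circ : A -> A -> A,
      is_snilpotent_brace_index circ k ->
      is_nilpotent_preLie_index (assoc_odot p n gamma circ) k /\
      (forall a b, flows_circ n (assoc_odot p n gamma circ) a b = circ a b)).
Proof.
move=> pp; rewrite addn1 => kp; rewrite addn2 => /ltnW/ltnW np cA gP.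
split=> [mul [preLie nilk]|circ [brace nilk]]; have k1 := nil_index_gt1 nilk;
  have kb : (1 < k < p)%N by rewrite k1.
  have [nil _] := nilk; have FT := strong_ser_filtration nil.
  have mulT := @strong_ser_graded A mul; have [mulDl [mulDr _]] := preLie.
  split; last exact: (assoc_odot_flows pp cA np k1 kp gP FT mulDl mulDr mulT).
  split; first exact: (flows_circ_brace pp cA np k1 kp gP FT mulDl mulDr mulT preLie).
  by rewrite /has_nil_index !(strong_ser_flows pp cA np kb gP preLie nil).
have [nil ne] := nilk; have FT := strong_ser_filtration nil.
have starT := @strong_ser_graded A (brace_star circ).
have fl := flows_assoc_odot pp cA np k1 kp gP FT brace starT.
have preLie := assoc_odot_preLie pp cA np k1 kp gP FT brace starT.
set mul := assoc_odot p n gamma circ in fl preLie *.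
have sub i : strong_ser mul i \subset strong_ser (brace_star circ) i.
  apply: strong_ser_min => // [{}i|{}i j x y _ _]; first exact: strong_ser_subgroup.
  exact: (assoc_odot_graded p n gamma FT starT).
(* Nilpotency of [mul] comes first from the inclusion [sub]; the equality of series can then be
   applied, the brace being the group of flows of [mul]. *)
have nil' : strong_ser mul k = [set 0].
  apply/eqP; rewrite eqEsubset -{1}nil sub sub1set.
  by have /addsubgroupP[] := strong_ser_subgroup mul k.
have ser i : strong_ser (brace_star circ) i = strong_ser mul i.
  rewrite -(strong_ser_flows pp cA np kb gP preLie nil').
  by apply: strong_ser_ext => x y; rewrite /brace_star fl.
by split=> //; split=> //; rewrite /has_nil_index -!ser.
Qed.
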